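(* Let $\mathsf{H}=\mathbb{R}^{N}$, let $\mathsf{K}_1$ and $\mathsf{K}_2$ be nonempty finite index sets, let $(\mathsf{u}_\kappa,\xi_\kappa)_{\kappa\in\mathsf{K}_1}$ and $(\mathsf{u}_\kappa,\xi_\kappa)_{\kappa\in\mathsf{K}_2}$ be finite collections in $\mathbb{R}^{N}\times\{-1,1\}$, and let $\alpha\in(0,1)$. For every $\mathsf{x}\in\mathsf{H}$ set $$(\forall\kappa\in\mathsf{K}_1)\ \ f_\kappa(\mathsf{x})=\alpha\max\{0,1-\xi_\kappa\langle\mathsf{x},\mathsf{u}_\kappa\rangle\},\qquad(\forall\kappa\in\mathsf{K}_2)\ \ g_\kappa(\mathsf{x})=(1-\alpha)\ln\bigl(1+\exp(-\xi_\kappa\langle\mathsf{x},\mathsf{u}_\kappa\rangle)\bigr).$$ Let $\mathsf{Z}$ be the set of minimizers over $\mathsf{H}$ of $$\mathsf{x}\mapsto\frac{1}{\operatorname{card}\mathsf{K}_1}\sum_{\kappa\in\mathsf{K}_1}f_\kappa(\mathsf{x})+\frac{1}{\operatorname{card}\mathsf{K}_2}\sum_{\kappa\in\mathsf{K}_2}g_\kappa(\mathsf{x}),$$ and assume that $\mathsf{Z}\neq\varnothing$. Let $(\Omega,\mathcal{F},\mathsf{P})$ be a complete probability space, let $x_0\in L^2(\Omega,\mathcal{F},\mathsf{P};\mathsf{H})$, and let $(\gamma_n)_{n\in\mathbb{N}}$ be a sequence in $(0,+\infty)$ such that $\sum_{n\in\mathbb{N}}\gamma_n=+\infty$ and $\sum_{n\in\mathbb{N}}\gamma_n^2<+\infty$.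 Iterate $$(\forall n\in\mathbb{N})\quad x_{n+1}=\operatorname{prox}_{\gamma_nf_{i_n}}\bigl(x_n-\gamma_n\nabla g_{j_n}(x_n)\bigr),$$ where, for every $n\in\mathbb{N}$, the random variable $(i_n,j_n)$ is uniformly distributed in $\mathsf{K}_1\times\mathsf{K}_2$ and independent of $\sigma(x_0,\ldots,x_n)$. Then $(x_n)_{n\in\mathbb{N}}$ converges $\mathsf{P}$-a.s. and in $L^1(\Omega,\mathcal{F},\mathsf{P};\mathsf{H})$ to a $\mathsf{Z}$-valued random variable.
   Context: For a lower semicontinuous convex function $h\colon\mathsf{H}\to(-\infty,+\infty]$ that is not identically $+\infty$, $\operatorname{prox}_h(\mathsf{x})=\operatorname{argmin}_{\mathsf{z}\in\mathsf{H}}\bigl(h(\mathsf{z})+\tfrac12\|\mathsf{x}-\mathsf{z}\|^2\bigr)$. For $p\in[1,+\infty)$, $L^p(\Omega,\mathcal{F},\mathsf{P};\mathsf{H})$ is the space of (classes of a.s. equal) $\mathsf{H}$-valued random variables $x$ with $\mathsf{E}\|x\|^p<+\infty$, with norm $(\mathsf{E}\|x\|^p)^{1/p}$. $\sigma(x_0,\ldots,x_n)$ is the $\sigma$-algebra generated by $x_0,\ldots,x_n$. *)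

(* Defs.v *)
From HB Require Import structures.
From mathcomp Require Import all_boot all_order all_algebra.
From mathcomp Require Import all_classical all_reals all_analysis.

Set Implicit Arguments.
Unset Strict Implicit.
Unset Printing Implicit Defensive.

Import Order.TTheory GRing.Theory Num.Theory.
Import numFieldNormedType.Exports.

Local Open Scope classical_set_scope.
Local Open Scope ring_scope.

Definition dot (R : realType) (N : nat) (x y : 'rV[R]_N) : R :=
  \sum_(i < N) x 0 i * y 0 i.

(* The library norm on 'rV[R]_N is the sup norm; it induces the same topology
   and the same Borel sets as enorm, but prox and L^p need the Euclidean one. *)
Definition enorm (R : realType) (N : nat) (x : 'rV[R]_N) : R :=
  Num.sqrt (dot x x).

Definition argmin (X : Type) (disp : Order.disp_t) (U : porderType disp)
    (F : X -> U) : set X :=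
  [set z | forall y, (F z <= F y)%O].

(* The argmin is a singleton when h is proper, lower semicontinuous and convex;
   get then returns its element. *)
Definition prox (R : realType) (N : nat) (h : 'rV[R]_N -> \bar R)
    (x : 'rV[R]_N) : 'rV[R]_N :=
  get (argmin (fun z => h z + (2^-1 * enorm (x - z) ^+ 2)%:E)%E).

Definition grad (R : realType) (N : nat) (g : 'rV[R]_N -> R)
    (x : 'rV[R]_N) : 'rV[R]_N :=
  \row_(i < N) 'D_(delta_mx 0 i) (g : 'rV[R]_N -> R^o) x.

Definition hinge (R : realType) (N : nat) (alpha : R) (u : 'rV[R]_N) (xi : R)
    (x : 'rV[R]_N) : R :=
  alpha * Num.max 0 (1 - xi * dot x u).

Definition logistic (R : realType) (N : nat) (alpha : R) (u : 'rV[R]_N)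
    (xi : R) (x : 'rV[R]_N) : R :=
  (1 - alpha) * ln (1 + expR (- (xi * dot x u))).

Definition borel (R : realType) (N : nat) : set (set 'rV[R]_N) :=
  <<s [set B : set 'rV[R]_N | open B] >>.

Definition random_vector d (T : measurableType d) (R : realType) (N : nat)
    (x : T -> 'rV[R]_N) : Prop :=
  forall B, borel B -> measurable (x @^-1` B).

(* sigma(x_0, ..., x_n) *)
Definition sigma_upto (T : Type) (R : realType) (N : nat)
    (x : nat -> T -> 'rV[R]_N) (n : nat) : set (set T) :=
  <<s \bigcup_(k in [set k | (k <= n)%N])
        preimage_set_system setT (x k) (@borel R N) >>.

Definition moment d (T : measurableType d) (R : realType) (P : probability T R)
    (N : nat) (p : R) (x : T -> 'rV[R]_N) : \bar R :=
  'E_P[fun w => enorm (x w) `^ p].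

Definition in_Lp d (T : measurableType d) (R : realType) (P : probability T R)
    (N : nat) (p : R) (x : T -> 'rV[R]_N) : Prop :=
  random_vector x /\ (moment P p x < +oo)%E.

Definition Lp_norm d (T : measurableType d) (R : realType)
    (P : probability T R) (N : nat) (p : R) (x : T -> 'rV[R]_N) : \bar R :=
  (moment P p x `^ p^-1)%E.

Definition cvg_in_Lp d (T : measurableType d) (R : realType)
    (P : probability T R) (N : nat) (p : R)
    (x : nat -> T -> 'rV[R]_N) (y : T -> 'rV[R]_N) : Prop :=
  [/\ forall n, in_Lp P p (x n), in_Lp P p y
    & (fun n => Lp_norm P p (fun w => x n w - y w)) @ \oo --> 0%E].

(* K carries the discrete sigma-algebra. *)
Definition uniform_rv d (T : measurableType d) (R : realType)
    (P : probability T R) (K : finType) (Y : T -> K) : Prop :=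
  (forall B : set K, measurable (Y @^-1` B)) /\
  (forall k : K, P (Y @^-1` [set k]) = (#|K|%:R^-1)%:E).

Definition independent_of d (T : measurableType d) (R : realType)
    (P : probability T R) (K : finType) (Y : T -> K)
    (G : set (set T)) : Prop :=
  forall (A : set T) (B : set K), G A ->
    P (A `&` Y @^-1` B) = (P A * P (Y @^-1` B))%E.

(* Main.v *)
Require Import Defs.
From HB Require Import structures.
From mathcomp Require Import all_boot all_order all_algebra.
From mathcomp Require Import all_classical all_reals all_analysis.
From mathcomp Require Import measurable_realfun.
From mathcomp Require Import ring lra.

(** Write [T_k] for the map [x |-> prox (x - gamma_n grad g_j x)] selected by the
    index pair [k = (i, j)] at time [n], and [Phi_k = f_i + g_j], so that the
    objective [F] is the average of the [Phi_k].  Each [T_k] moves its argument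
    by [O(gamma_n)], and convexity of [f_i] and [g_j] together with the
    Lipschitz property of the hinge loss gives, for every [z]
    ([fb_step_descent]),
      [|T_k x - z|^2 <= |x - z|^2 - 2 gamma_n (Phi_k x - Phi_k z) + C gamma_n^2].
    Averaged over [k], the middle term becomes [2 gamma_n (F x - F z)], which is
    nonnegative when [z] minimizes [F].

    The random error is the difference between [|x_(n+1) - z|^2] and the average
    of [|T_k x_n - z|^2].  As [(i_n, j_n)] is uniform and independent of
    [x_0, .., x_n], this is a martingale increment for the filtration of the
    iterates, with conditional variance [O(gamma_n^2 (1 + |x_n|^2))]; hence its
    partial sums form an L^2 martingale and converge almost surely
    ([noise_series_cvg], by Doob's maximal inequality).  Conditional expectations
    never appear as such: the conditional law of [x_(n+1)] is an explicit finite
    average, so every conditioning step is an identity between integrals over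
    events of the past ([integral_step]).  Independence refers to the iterates
    only, and the indices [i_k], [j_k] with [k < n] need not be functions of
    [x_0, .., x_n]; this is why the martingale is built from the iterates
    [x_(k+1)] and not from the values [Phi_(k) (x_k)] at the drawn indices.

    The error for [z] is an affine combination, with coefficients depending on
    [z], of the errors for [|.|^2] and for the [N] coordinates
    ([noise_sqdist]).  Outside one null set all of these sums converge, and the
    remaining argument is deterministic: for every minimizer [z] the sequence
    [|x_n - z|^2] converges and the sum of the [gamma_n (F x_n - F z)] is finite
    ([perturbed_descent_cvg]).  Since the sum of the [gamma_n] is infinite, [F]
    gets arbitrarily close to its minimum along the sequence
    ([weighted_sum_liminf]); a cluster point there is a minimizer, and its
    distance to [x_n] converges, hence tends to [0] ([fejer_cvg]).

    The same descent inequality bounds [E |x_n|^2] uniformly, and a sequence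
    bounded in L^2 that converges almost surely converges in L^1
    ([L2_bounded_L1_cvg]). *)

Set Implicit Arguments.
Unset Strict Implicit.
Unset Printing Implicit Defensive.

Import Order.TTheory GRing.Theory Num.Theory.
Import numFieldNormedType.Exports.

Local Open Scope classical_set_scope.
Local Open Scope ring_scope.

(** * The Euclidean inner product, continuity and the proximity operator *)

Section real_valued_continuity.
Context {R : realType} {X : topologicalType}.
Implicit Types h k : X -> R.

Lemma continuous_mul h k : continuous h -> continuous k ->
  continuous (fun x => h x * k x).
Proof. by move=> hc kc x; exact: (continuousM (hc x) (kc x)). Qed.

Lemma continuous_add h k : continuous h -> continuous k ->
  continuous (fun x => h x + k x).
Proof. by move=> hc kc x; exact: (@continuousD R R^o _ _ _ _ (hc x) (kc x)). Qed.

Lemma continuous_sqr h : continuous h -> continuous (fun x => h x ^+ 2).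
Proof.
move=> hc; under eq_fun do rewrite expr2.
exact: continuous_mul.
Qed.

Lemma continuous_opp h : continuous h -> continuous (fun x => - h x).
Proof. by move=> hc x; exact: (@continuousN R R^o _ _ _ (hc x)). Qed.

Lemma continuous_cst (a : R) : continuous (fun _ : X => a).
Proof. by move=> x; exact: cvg_cst. Qed.

Lemma continuous_maxr h k : continuous h -> continuous k ->
  continuous (fun x => Num.max (h x) (k x)).
Proof. by move=> hc kc x; exact: (continuous_max (hc x) (kc x)). Qed.

Lemma continuous_minr h k : continuous h -> continuous k ->
  continuous (fun x => Num.min (h x) (k x)).
Proof. by move=> hc kc x; exact: (continuous_min (hc x) (kc x)). Qed.

Lemma continuous_compr {Y : topologicalType} (h : X -> R) (k : R -> Y) :
  continuous h -> continuous k -> continuous (fun x => k (h x)).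
Proof. by move=> hc kc x; exact: (continuous_comp (hc x) (kc (h x))). Qed.

Lemma continuous_sumr (I : Type) (r : seq I) (h : I -> X -> R) :
  (forall i, continuous (h i)) -> continuous (fun x => \sum_(i <- r) h i x).
Proof.
move=> hc; apply: (@continuous_big R^o _ +%R 0 xpredT) => //.
exact: (@add_continuous R^o).
Qed.

End real_valued_continuity.

Section euclidean.
Context {R : realType} {N : nat}.
Implicit Types (x y z u v : 'rV[R]_N) (a b t : R).

Lemma dotC x y : dot x y = dot y x.
Proof. by apply: eq_bigr => i _; rewrite mulrC. Qed.

Lemma dotDl x y z : dot (x + y) z = dot x z + dot y z.
Proof. by rewrite -big_split; apply: eq_bigr => i _; rewrite mxE mulrDl. Qed.

Lemma dotZl a x z : dot (a *: x) z = a * dot x z.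
Proof. by rewrite mulr_sumr; apply: eq_bigr => i _; rewrite mxE mulrA. Qed.

Lemma dotNl x z : dot (- x) z = - dot x z.
Proof. by rewrite -scaleN1r dotZl mulN1r. Qed.

Lemma dot0l z : dot 0 z = 0.
Proof. by rewrite -(scale0r (0 : 'rV[R]_N)) dotZl mul0r. Qed.

Lemma dotDr x y z : dot z (x + y) = dot z x + dot z y.
Proof. by rewrite dotC dotDl !(dotC z). Qed.

Lemma dotZr a x z : dot z (a *: x) = a * dot z x.
Proof. by rewrite dotC dotZl (dotC z). Qed.

Lemma dotNr x z : dot z (- x) = - dot z x.
Proof. by rewrite dotC dotNl (dotC z). Qed.

Definition dotE := (dotDl, dotDr, dotNl, dotNr, dotZl, dotZr).

Lemma dot_ge0 x : 0 <= dot x x.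
Proof. by apply: sumr_ge0 => i _; rewrite -expr2 sqr_ge0. Qed.

Lemma dot_eq0 x : dot x x <= 0 -> x = 0.
Proof.
move=> x0; apply/rowP => i; rewrite mxE; apply/eqP.
have /eqP : dot x x = 0 by apply/eqP; rewrite eq_le x0 dot_ge0.
rewrite psumr_eq0 => [|k _]; last by rewrite -expr2 sqr_ge0.
by move/allP => /(_ i); rewrite mem_index_enum mulf_eq0 orbb => /(_ isT).
Qed.

Lemma enorm_sqr x : enorm x ^+ 2 = dot x x.
Proof. by rewrite sqr_sqrtr // dot_ge0. Qed.

Lemma enorm_ge0 x : 0 <= enorm x.
Proof. exact: sqrtr_ge0. Qed.

Lemma sqr_coord_le x i : x 0 i ^+ 2 <= dot x x.
Proof.
rewrite /dot (bigD1 i) //= expr2 lerDl.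
by apply: sumr_ge0 => k _; rewrite -expr2 sqr_ge0.
Qed.

Lemma dot_parallelogram x y : dot (x - y) (x - y) <= 2 * dot x x + 2 * dot y y.
Proof. by have := dot_ge0 (x + y); rewrite !dotE (dotC y x); lra. Qed.

Lemma continuous_coord k : continuous (fun x : 'rV[R]_N => x 0 k).
Proof. exact: (@coord_continuous R 1 N 0 k). Qed.

Lemma continuous_dotl u : continuous (fun x : 'rV[R]_N => dot x u).
Proof.
apply: continuous_sumr => k; apply: continuous_mul; first exact: continuous_coord.
exact: continuous_cst.
Qed.

Lemma continuous_sqdot z : continuous (fun x : 'rV[R]_N => dot (x - z) (x - z)).
Proof.
apply: continuous_sumr => k.
suff h : continuous (fun x : 'rV[R]_N => (x - z) 0 k) by exact: continuous_mul.
rewrite (_ : (fun _ => _) = (fun x => x 0 k - z 0 k)).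
  by apply: continuous_add; [exact: continuous_coord|exact: continuous_cst].
by apply/funext => x; rewrite !mxE.
Qed.

Lemma continuous_sqnorm : continuous (fun x : 'rV[R]_N => dot x x).
Proof.
rewrite (_ : (fun x : 'rV[R]_N => dot x x) = (fun x => dot (x - 0) (x - 0))).
  exact: continuous_sqdot.
by apply/funext => x; rewrite subr0.
Qed.

Lemma continuous_enorm : continuous (@enorm R N).
Proof.
by apply: continuous_compr; [exact: continuous_sqnorm|exact: sqrt_continuous].
Qed.

(** When [y - p] is a subgradient of [h] at [p], completing the square shows
    that [z |-> h z + 2^-1 * |y - z|^2] exceeds its value at [p] by at least
    [2^-1 * |p - z|^2]; so [p] is the only point that [get] can return. *)
Lemma prox_subgradient (h : 'rV[R]_N -> R) y p :
  (forall z, h p + dot (y - p) (z - p) <= h z) ->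
  prox (fun z => (h z)%:E) y = p.
Proof.
move=> hp; rewrite /prox; set A := argmin _.
have key z : h p + 2^-1 * enorm (y - p) ^+ 2 + 2^-1 * dot (z - p) (z - p) <=
             h z + 2^-1 * enorm (y - z) ^+ 2.
  rewrite !enorm_sqr; have -> : y - z = (y - p) - (z - p).
    by rewrite opprB addrA subrK.
  have := hp z; move: (y - p) (z - p) => a b.
  by rewrite !dotE (dotC b a); lra.
have Ap : A p.
  move=> z /=; rewrite -!EFinD lee_fin; apply: le_trans (key z).
  by rewrite lerDl mulr_ge0 ?dot_ge0 // invr_ge0.
have /= := @getPex _ A (ex_intro _ p Ap).
move: (get A) => q Aq; have := Aq p; rewrite /= -!EFinD lee_fin => hq.
apply/eqP; rewrite -subr_eq0; apply/eqP/dot_eq0.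
by have := le_trans (key q) hq; have := dot_ge0 (q - p); lra.
Qed.

End euclidean.

Lemma cauchy_schwarz_dot {R : realType} {N : nat} (x y : 'rV[R]_N) :
  dot x y ^+ 2 <= dot x x * dot y y.
Proof.
have := dot_ge0 (dot x x *: y - dot x y *: x).
have [x0|xN0] := eqVneq (dot x x) 0.
  have -> : x = 0 by apply: dot_eq0; rewrite x0.
  by rewrite !dot0l mul0r expr0n.
have x0 : 0 < dot x x by rewrite lt_def xN0 dot_ge0.
rewrite !dotE (dotC y x) => h; rewrite -subr_ge0 -(pmulr_rge0 _ x0).
by move: h; congr (_ <= _); ring.
Qed.

(** * The hinge proximity operator and the logistic gradient *)

Section hinge_prox.
Context {R : realType} {N : nat}.
Implicit Types (x y z u : 'rV[R]_N) (c xi : R).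

(** The proximity operator of the hinge loss moves [y] along [xi *: u] until the
    margin [1 - xi * dot y u] vanishes, but by a multiple of at most [c].  For
    [u = 0] the quotient is [0], and the step is trivial anyway. *)
Definition hinge_mult c u xi y : R :=
  Num.min c (Num.max 0 ((1 - xi * dot y u) / dot u u)).

Definition hinge_step c u xi y : 'rV[R]_N := y + (hinge_mult c u xi y * xi) *: u.

Lemma hinge_mult_itv c u xi y : 0 <= c -> 0 <= hinge_mult c u xi y <= c.
Proof. by move=> c0; rewrite /hinge_mult le_min c0 le_max lexx ge_min lexx. Qed.

(** Complementary slackness: at the new point the multiplier equals [c] if the
    margin is positive and [0] if it is negative, so it belongs to [c] times the
    subdifferential of [Num.max 0] there. *)
Lemma hinge_mult_subgradient c u xi y z : 0 <= c -> xi ^+ 2 = 1 ->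
  c * Num.max 0 (1 - xi * dot (hinge_step c u xi y) u)
    + hinge_mult c u xi y * (xi * dot (hinge_step c u xi y - z) u) <=
  c * Num.max 0 (1 - xi * dot z u).
Proof.
move=> c0 xi2; set p := hinge_step _ _ _ _.
have [u0|u_neq0] := eqVneq u 0.
  have d0 v : dot v u = 0 by rewrite u0 dotC dot0l.
  by rewrite !d0 !mulr0 addr0.
have q0 : 0 < dot u u.
  by rewrite lt_def dot_ge0 andbT; apply: contra_neq u_neq0 => q0; apply/dot_eq0; rewrite q0.
have /andP[t0 tc] := hinge_mult_itv u xi y c0.
have pu : 1 - xi * dot p u = ((1 - xi * dot y u) / dot u u - hinge_mult c u xi y) * dot u u.
  rewrite mulrBl divfK ?gt_eqF// /p /hinge_step !dotE.
  by rewrite mulrDr !mulrA -(mulrC (hinge_mult c u xi y)) -(mulrA _ xi xi) -expr2 xi2; ring.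
have slack : (hinge_mult c u xi y = c \/ 1 - xi * dot p u <= 0) /\
             (hinge_mult c u xi y = 0 \/ 0 <= 1 - xi * dot p u).
  rewrite pu pmulr_lle0// pmulr_lge0// subr_le0 subr_ge0 /hinge_mult.
  move: ((1 - _) / _) => r; split.
    by case: (leP c) => ?; [left|right; rewrite le_max lexx orbT].
  case: (leP 0 r) => ?.
    by right; rewrite ge_min lexx orbT.
  by left; apply/min_idPr.
move: (hinge_mult _ _ _ _) t0 tc slack {pu} => t t0 tc.
rewrite dotDl dotNl; move: (dot p u) (dot z u) => a b.
have [sb|sb] := leP 0 (1 - xi * b); have [sa|sa] := leP 0 (1 - xi * a); move=> [[->|?] [t_0|?]];
  by nra.
Qed.

Lemma prox_hinge (g a : R) u xi y : 0 <= g * a -> xi ^+ 2 = 1 ->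
  prox (fun z => (g * hinge a u xi z)%:E) y = hinge_step (g * a) u xi y.
Proof.
move=> c0 xi2; apply: prox_subgradient => z.
have := hinge_mult_subgradient u y z c0 xi2; rewrite /hinge !mulrA => h.
have yp : y - hinge_step (g * a) u xi y = - ((hinge_mult (g * a) u xi y * xi) *: u).
  by rewrite /hinge_step opprD addrA subrr add0r.
rewrite yp; apply: le_trans h; rewrite lerD2l.
move: (hinge_step _ _ _ _) => p.
by rewrite !dotE (dotC u p) (dotC u z); lra.
Qed.

End hinge_prox.

Section logistic_gradient.
Context {R : realType}.
Implicit Types (s t a : R).

Definition sigmoid s : R := expR (- s) / (1 + expR (- s)).

Lemma expR1_gt0 s : 0 < 1 + expR (- s).
Proof. by rewrite ltr_wpDl ?expR_gt0. Qed.

Lemma sigmoid_itv s : 0 <= sigmoid s <= 1.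
Proof.
have s0 := expR1_gt0 s; apply/andP; split.
  by rewrite /sigmoid divr_ge0 ?expR_ge0 ?ltW.
by rewrite /sigmoid ler_pdivrMr// mul1r lerDr.
Qed.

(** With [q = sigmoid s] and [e = t - s], exponentiation turns this tangent
    inequality into [expR (- (q * e)) <= (1 - q) + q * expR (- e)], and this is
    the combination with weights [1 - q] and [q] of the bound [1 + r <= expR r]
    used at [r = q * e] and at [r = - (1 - q) * e]. *)
Lemma softplus_tangent s t :
  ln (1 + expR (- s)) - sigmoid s * (t - s) <= ln (1 + expR (- t)).
Proof.
have s0 := expR1_gt0 s; have /andP[q0 q1] := sigmoid_itv s.
set q := sigmoid s in q0 q1 *.
have qE : expR (- s) = q * (1 + expR (- s)) by rewrite /q /sigmoid divfK// gt_eqF.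
rewrite -ler_expR expRD !lnK ?posrE ?expR1_gt0//.
have -> : 1 + expR (- t) = (1 + expR (- s)) * (1 - q + q * expR (- (t - s))).
  have -> : expR (- t) = expR (- s) * expR (- (t - s)).
    by rewrite -expRD; congr expR; ring.
  by rewrite mulrDr mulrBr mulr1 mulrA !(mulrC _ q) -qE; ring.
rewrite ler_pM2l//; move: (t - s) => e.
have E0 := expR_gt0 (- (q * e)).
have h1 : expR (- (q * e)) * (1 + q * e) <= 1.
  by rewrite -[leRHS](expRxMexpNx_1 (q * e)) mulrC ler_pM2r// expR_ge1Dx.
have h2 : expR (- (q * e)) * (1 - (1 - q) * e) <= expR (- e).
  have -> : expR (- e) = expR (- (q * e)) * expR (- ((1 - q) * e)).
    by rewrite -expRD; congr expR; ring.
  by rewrite ler_pM2l// expR_ge1Dx.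
by move: (expR (- (q * e))) (expR (- e)) E0 h1 h2 => E1 E2; nra.
Qed.

Lemma softplus_derive (b c : R) :
  is_derive (0 : R) (1 : R) (fun h : R => ln (1 + expR (- (b * h + c))))
    (- (sigmoid c * b)).
Proof.
have d0 : is_derive (0 : R) (1 : R) (fun h : R => - (b * h + c)) (- b).
  apply: is_derive_eq.
  by rewrite addr0 /GRing.scale /= mulr1.
have d1 : is_derive (0 : R) (1 : R) (fun h : R => 1 + expR (- (b * h + c))) (expR (- c) * - b).
  have := @is_derive1_comp R expR (fun h => - (b * h + c)) 0 _ _ (is_derive_expR _) d0.
  rewrite mulr0 add0r => dc.
  apply: is_derive_eq.
  by rewrite add0r mul1r.
have c1 : 0 < 1 + expR (- (b * 0 + c)) by exact: expR1_gt0.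
have := @is_derive1_comp R (@ln R) (fun h => 1 + expR (- (b * h + c))) 0 _ _ (is_derive1_ln c1) d1.
rewrite mulr0 add0r => dl; apply: is_derive_eq dl _.
by rewrite /sigmoid; ring.
Qed.

Lemma grad_logistic (N : nat) (a xi : R) (u x : 'rV[R]_N) :
  grad (logistic a u xi) x = (- ((1 - a) * sigmoid (xi * dot x u) * xi)) *: u.
Proof.
apply/rowP => k; rewrite !mxE.
have ku : dot (delta_mx 0 k) u = u 0 k.
  rewrite /dot (bigD1 k) //= big1 => [|l lk]; rewrite !mxE ?eqxx ?mul1r ?addr0//.
  by rewrite (negPf lk) mul0r.
pose phi h : R := ln (1 + expR (- ((xi * u 0 k) * h + xi * dot x u))).
have dphi := softplus_derive (xi * u 0 k) (xi * dot x u).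
(* On the line through x in direction k, the loss is a softplus of an affine
   function of the line parameter. *)
transitivity ('D_1 ((1 - a) \*: phi : R -> R) 0).
  apply: (congr1 (fun F : R -> R^o => lim (F @ 0^'))).
  apply/funext => h /=.
  rewrite /logistic /phi /= addr0 mulr0 add0r dotDl dotZl ku.
  rewrite /GRing.scale /= mulr1; congr (_ * (_ * ln (1 + expR (- _)) - _)); ring.
have dp : is_derive (0 : R) (1 : R) ((1 - a) \*: phi : R -> R)
    ((1 - a) *: - (sigmoid (xi * dot x u) * (xi * u 0 k))).
  exact: is_deriveZ.
by rewrite derive_val /GRing.scale /=; ring.
Qed.

End logistic_gradient.

(** * One forward-backward step *)

Lemma continuous_expRN {R : realType} : continuous (fun s : R => expR (- s)).
Proof.
apply: continuous_compr; last exact: continuous_expR.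
exact: opp_continuous.
Qed.

Lemma continuous_sigmoid {R : realType} : continuous (@sigmoid R).
Proof.
apply: continuous_mul; first exact: continuous_expRN.
have h : continuous (fun s : R => 1 + expR (- s)).
  by apply: continuous_add; [exact: continuous_cst|exact: continuous_expRN].
by move=> s; apply: (cvgV _ (h s)); rewrite gt_eqF// expR1_gt0.
Qed.

Section forward_backward.
Context {R : realType} {N : nat}.
Variables (alpha xi1 xi2 : R) (u1 u2 : 'rV[R]_N).
Hypotheses (alpha_gt0 : 0 < alpha) (alpha_lt1 : alpha < 1).
Hypotheses (xi1_sqr : xi1 ^+ 2 = 1) (xi2_sqr : xi2 ^+ 2 = 1).
Implicit Types (x y z : 'rV[R]_N) (c : R).

Let f := hinge alpha u1 xi1.
Let g := logistic alpha u2 xi2.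

Definition fb_step c x : 'rV[R]_N :=
  hinge_step (c * alpha) u1 xi1 (x - c *: grad g x).

Lemma fb_stepE c x : fb_step c x = x
  + (c * ((1 - alpha) * sigmoid (xi2 * dot x u2) * xi2)) *: u2
  + (hinge_mult (c * alpha) u1 xi1 (x - c *: grad g x) * xi1) *: u1.
Proof.
rewrite /fb_step /hinge_step; congr (_ + _).
by rewrite grad_logistic scaleNr scalerN opprK scalerA.
Qed.

(** Both parts of the step are multiples of fixed vectors with coefficients at
    most [c], because the logistic loss has bounded gradient and the hinge loss
    bounded subgradients; so the bound is uniform in [x]. *)
Lemma fb_step_displacement c x : 0 <= c ->
  dot (fb_step c x - x) (fb_step c x - x) <=
  c ^+ 2 * (2 * dot u1 u1 + 2 * dot u2 u2).
Proof.
move=> c0; rewrite fb_stepE.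
have /andP[t0 t1] : 0 <= hinge_mult (c * alpha) u1 xi1 (x - c *: grad g x) <= c * alpha.
  by apply: hinge_mult_itv; rewrite mulr_ge0// ltW.
have /andP[s0 s1] := sigmoid_itv (xi2 * dot x u2).
move: (hinge_mult _ _ _ _) t0 t1 (sigmoid _) s0 s1 => t t0 t1 s s0 s1.
rewrite (addrC x) addrAC addrK.
set a := _ *: u2; set b := _ *: u1.
have -> : a + b = b - (- a) by rewrite opprK addrC.
apply: le_trans (dot_parallelogram _ _) _; rewrite dotNl dotNr opprK.
have -> : dot a a = (c * ((1 - alpha) * s)) ^+ 2 * xi2 ^+ 2 * dot u2 u2.
  by rewrite /a !dotE; ring.
have -> : dot b b = t ^+ 2 * xi1 ^+ 2 * dot u1 u1 by rewrite /b !dotE; ring.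
rewrite xi1_sqr xi2_sqr !mulr1.
have tc : t ^+ 2 <= c ^+ 2.
  rewrite ler_sqr ?nnegrE//; apply: le_trans t1 _.
  by rewrite ler_piMr// ltW.
have sc : (c * ((1 - alpha) * s)) ^+ 2 <= c ^+ 2.
  have as1 : (1 - alpha) * s <= 1 by have := mulr_ge0 (ltW alpha_gt0) s0; lra.
  have as0 : 0 <= (1 - alpha) * s by rewrite mulr_ge0// subr_ge0; apply: ltW.
  by apply: lerXn2r; rewrite ?nnegrE ?(mulr_ge0 c0)//; exact: ler_piMr.
by have := ler_wpM2r (dot_ge0 u1) tc; have := ler_wpM2r (dot_ge0 u2) sc; lra.
Qed.

Lemma logistic_tangent x z : g x + dot (grad g x) (z - x) <= g z.
Proof.
rewrite grad_logistic dotZl (dotC u2) dotDl dotNl /g /logistic.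
have := softplus_tangent (xi2 * dot x u2) (xi2 * dot z u2).
by rewrite -(@ler_pM2l _ (1 - alpha)) ?subr_gt0//; lra.
Qed.

Lemma hinge_le_shift x z : f x <= f z + alpha * `|dot (x - z) u1|.
Proof.
rewrite /f /hinge -mulrDr ler_pM2l//.
have : `|xi1 * dot (x - z) u1| = `|dot (x - z) u1|.
  have : `|xi1| ^+ 2 = 1 by rewrite -normrX xi1_sqr normr1.
  by move/eqP; rewrite sqrp_eq1// => /eqP x1; rewrite normrM x1 mul1r.
rewrite dotDl dotNl => <-; move: (dot x u1) (dot z u1) => a b.
rewrite ge_max; apply/andP; split.
  by rewrite addr_ge0// le_max lexx.
have := ler_norm (- (xi1 * (a - b))); rewrite normrN.
have : 1 - xi1 * b <= Num.max 0 (1 - xi1 * b) by rewrite le_max lexx orbT.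
by move: (Num.max _ _) => m; nra.
Qed.

(** Expand the square of [(x - z) + (fb_step c x - x)].  In the cross term, the
    forward direction is controlled by convexity of [g] at [x] and the backward
    one by convexity of [f] at [fb_step c x]; replacing [f (fb_step c x)] by
    [f x] costs only [O(c ^+ 2)] since [f] is Lipschitz and the displacement is
    [O(c)]. *)
Lemma fb_step_descent c x z : 0 <= c ->
  dot (fb_step c x - z) (fb_step c x - z) <=
  dot (x - z) (x - z) - 2 * c * ((f x + g x) - (f z + g z))
  + c ^+ 2 * (8 * dot u1 u1 + 8 * dot u2 u2).
Proof.
move=> c0; have disp := fb_step_displacement x c0.
have cg := ler_wpM2l c0 (logistic_tangent x z).
have cs : 0 <= c * alpha by rewrite mulr_ge0// ltW.
have sub := hinge_mult_subgradient u1 (x - c *: grad g x) z cs xi1_sqr.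
have /andP[t0 t1] := hinge_mult_itv u1 xi1 (x - c *: grad g x) cs.
have lip := ler_wpM2l c0 (hinge_le_shift x (fb_step c x)).
have eE : fb_step c x - x = - (c *: grad g x) +
    (hinge_mult (c * alpha) u1 xi1 (x - c *: grad g x) * xi1) *: u1.
  rewrite [X in X - _]fb_stepE grad_logistic scaleNr scalerN opprK scalerA.
  by rewrite (addrC x) addrAC addrK.
rewrite -/(fb_step c x) in sub.
move: (fb_step c x) (grad g x) (hinge_mult _ _ _ _) disp cg sub t0 t1 lip eE => p G t.
move=> disp cg sub t0 t1 lip eE.
have -> : p - z = (x - z) + (p - x) by rewrite [RHS]addrC subrKA.
have Dx : dot (x - p) u1 = - dot (p - x) u1 by rewrite -dotNl opprB.
rewrite Dx normrN in lip.
have pz : dot (p - z) u1 = dot (x - z) u1 + dot (p - x) u1.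
  by rewrite -dotDl [in RHS](addrC (x - z)) subrKA.
have ex : dot (p - x) (x - z) = - (c * dot G (x - z)) + t * xi1 * dot (x - z) u1.
  by rewrite eE !dotE (dotC u1 x) (dotC u1 z); ring.
have Gx : dot G (z - x) = - dot G (x - z) by rewrite -dotNr opprB.
have fzE : c * f z = c * alpha * Num.max 0 (1 - xi1 * dot z u1) by rewrite mulrA.
have fpE : c * f p = c * alpha * Num.max 0 (1 - xi1 * dot p u1) by rewrite mulrA.
rewrite -fzE -fpE pz in sub; rewrite Gx in cg.
have xn : `|xi1 * dot (p - x) u1| = `|dot (p - x) u1|.
  have : `|xi1| ^+ 2 = 1 by rewrite -normrX xi1_sqr normr1.
  by move/eqP; rewrite sqrp_eq1// => /eqP x1; rewrite normrM x1 mul1r.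
(* Young's inequality turns the Lipschitz error into terms of order c ^+ 2. *)
have young : 2 * c * `|dot (p - x) u1| <= dot (p - x) (p - x) + c ^+ 2 * dot u1 u1.
  have h1 := dot_ge0 ((p - x) + c *: u1); have h2 := dot_ge0 ((p - x) - c *: u1).
  move: (p - x) h1 h2 => e; rewrite !dotE (dotC u1 e) => h1 h2.
  by case: (ler0P (dot e u1)) => _; lra.
have tn : - (c * `|dot (p - x) u1|) <= t * (xi1 * dot (p - x) u1).
  have : - `|dot (p - x) u1| <= xi1 * dot (p - x) u1.
    by rewrite -xn lerNl -normrN ler_norm.
  have := normr_ge0 (dot (p - x) u1).
  have : t <= c by apply: le_trans t1 _; rewrite ler_piMr// ltW.
  by move: (xi1 * _) `|_| => a b tc b0 ba; nra.
have al : c * (alpha * `|dot (p - x) u1|) <= c * `|dot (p - x) u1|.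
  by rewrite ler_wpM2l// ler_piMl// ltW.
have -> (a b : 'rV[R]_N) : dot (a + b) (a + b) = dot a a + 2 * dot b a + dot b b.
  by rewrite !dotE (dotC a b); ring.
rewrite ex.
have := mulr_ge0 (sqr_ge0 c) (dot_ge0 u2).
by lra.
Qed.

Lemma continuous_fb_step c : continuous (fb_step c).
Proof.
have cZ (w : 'rV[R]_N) (k : 'rV[R]_N -> R^o) :
    continuous k -> continuous (fun y => k y *: w).
  by move=> kc x; exact: (@cvgZr_tmp _ _ _ _ _ k _ w (kc x)).
have sc : continuous (fun x => sigmoid (xi2 * dot x u2)).
  apply: continuous_compr; last exact: continuous_sigmoid.
  by apply: continuous_mul; [exact: continuous_cst|exact: continuous_dotl].
have gc : continuous (grad g).
  rewrite (_ : grad g = fun x => (- ((1 - alpha) * sigmoid (xi2 * dot x u2) * xi2)) *: u2).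
    apply: cZ; apply: continuous_opp; apply: continuous_mul; last exact: continuous_cst.
    by apply: continuous_mul => //; exact: continuous_cst.
  by apply/funext => y; rewrite grad_logistic.
have hc : continuous (hinge_step (c * alpha) u1 xi1).
  suff h : continuous (fun y => (hinge_mult (c * alpha) u1 xi1 y * xi1) *: u1).
    by move=> x; exact: (cvgD cvg_id (h x)).
  apply: cZ; apply: continuous_mul; last exact: continuous_cst.
  apply: continuous_minr; first exact: continuous_cst.
  apply: continuous_maxr; first exact: continuous_cst.
  apply: continuous_mul; last exact: continuous_cst.
  apply: continuous_add; first exact: continuous_cst.
  apply: continuous_opp; apply: continuous_mul; first exact: continuous_cst.
  exact: continuous_dotl.
have fc : continuous (fun x => x - c *: grad g x).
  by move=> x; exact: (cvgB cvg_id (cvgZl_tmp (gc x))).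
by move=> x; exact: (continuous_comp (fc x) (hc _)).
Qed.

Lemma continuous_hinge : continuous f.
Proof.
apply: continuous_mul; first exact: continuous_cst.
apply: continuous_maxr; first exact: continuous_cst.
apply: continuous_add; first exact: continuous_cst.
apply: continuous_opp; apply: continuous_mul; first exact: continuous_cst.
exact: continuous_dotl.
Qed.

Lemma continuous_logistic : continuous g.
Proof.
apply: continuous_mul; first exact: continuous_cst.
have sc : continuous (fun x => 1 + expR (- (xi2 * dot x u2))).
  apply: continuous_add; first exact: continuous_cst.
  apply: continuous_compr; last exact: continuous_expR.
  apply: continuous_opp; by apply: continuous_mul; [exact: continuous_cst|exact: continuous_dotl].
by move=> x; exact: (continuous_comp (sc x) (continuous_ln (expR1_gt0 _))).
Qed.

End forward_backward.

(** * Deterministic convergence lemmas *)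

(** The difference between [v] and the partial sums of [D] and [a] is
    nonincreasing and bounded below; its total decrease dominates the sum of
    [b].  [D] has no sign: only the convergence of its series matters, which is
    what a martingale provides. *)
Lemma perturbed_descent_cvg {R : realType} (v D a b : R^nat) :
  (forall n, 0 <= v n) -> (forall n, 0 <= b n) ->
  (forall n, v n.+1 <= v n + D n + a n - b n) ->
  cvgn (series D) -> cvgn (series a) ->
  cvgn v /\ exists M, forall n, series b n <= M.
Proof.
move=> v0 b0 vS cD ca.
pose s n := series D n + series a n.
have cs : cvgn s by exact: is_cvgD.
have [M sM] : exists M, forall n, `|s n| <= M.
  have [M [_ sM]] := cvg_seq_bounded cs.
  by exists (M + 1) => n; apply: (sM (M + 1)) => //; rewrite ltrDl.
have sS n : s n.+1 = s n + D n + a n by rewrite /s !seriesSr; ring.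
split.
  have cw : cvgn (v \- s).
    apply: nonincreasing_is_cvgn.
      by apply/nonincreasing_seqP => n /=; rewrite sS; have := vS n; have := b0 n; lra.
    exists (- M) => _ [n _ <-] /=.
    by have := v0 n; have := ler_norm (s n); have := sM n; lra.
  rewrite (_ : v = (v \- s) \+ s); first exact: is_cvgD.
  by apply/funext => n /=; rewrite subrK.
exists (v 0%N + M) => n.
suff : v n + series b n <= v 0%N + s n.
  by have := v0 n; have := ler_norm (s n); have := sM n; lra.
elim: n => [|n IHn].
  by rewrite /s !seriesEnat /= !big_geq// !addr0.
by rewrite sS seriesSr; have := vS n; lra.
Qed.

(** If [phi] stayed above [e] from some rank [n] on, the sum of [g] beyond [n]
    would be at most [M / e]. *)
Lemma weighted_sum_liminf {R : realType} (g phi : R^nat) (M : R) :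
  (forall n, 0 < g n) -> (\sum_(0 <= n <oo) (g n)%:E = +oo)%E ->
  (forall n, series (fun k => g k * phi k) n <= M) ->
  (forall n, 0 <= phi n) ->
  forall e, 0 < e -> forall n, exists2 m, (n <= m)%N & phi m < e.
Proof.
move=> g0 goo sM phi0 e e0 n; apply: contrapT => /forall2NP h.
have phie m : (n <= m)%N -> e <= phi m.
  by move=> nm; have [//|/negP] := h m; rewrite -leNgt.
suff : (\sum_(0 <= n <oo) (g n)%:E <= (series g n + M / e)%:E)%E by rewrite goo.
apply: lime_le.
  by apply: is_cvg_nneseries => k _ _; rewrite lee_fin ltW.
apply: nearW => m; rewrite sumEFin lee_fin.
have M0 : 0 <= M / e.
  by rewrite divr_ge0 ?(ltW e0)//; have := sM 0%N; rewrite seriesEnat /= big_geq.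
suff : series g m <= series g n + M / e by [].
have [mn|nm] := leqP m n.
  apply: ler_wpDr => //; rewrite !seriesEnat /= [leRHS](big_cat_nat (leq0n m) mn) /=.
  by rewrite lerDl sumr_ge0// => k _; exact/ltW.
rewrite -lerBlDl ler_pdivlMr//; apply: le_trans (sM m).
rewrite !seriesEnat /= (big_cat_nat (leq0n n) (ltnW nm)) /= addrAC subrr add0r.
rewrite (big_cat_nat (leq0n n) (ltnW nm)) /= mulr_suml.
apply: ler_wpDl; first by apply: sumr_ge0 => k _; rewrite mulr_ge0 ?phi0 ?ltW.
apply: ler_sum_nat => k /andP[nk _].
by rewrite ler_pM2l// phie.
Qed.

(** Points where [F] is close to its minimum have a cluster point [a], which is a
    minimizer by continuity of [F].  Then the distance from [x n] to [a]
    converges and is arbitrarily small infinitely often, so its limit is [0]. *)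
Lemma fejer_cvg {R : realType} {N : nat} (F : 'rV[R]_N -> R)
    (x : nat -> 'rV[R]_N) (z0 : 'rV[R]_N) :
  continuous F -> argmin F z0 ->
  (forall z, argmin F z -> cvgn (fun n => dot (x n - z) (x n - z))) ->
  (forall e, 0 < e -> forall n, exists2 m, (n <= m)%N & F (x m) < F z0 + e) ->
  exists2 y, argmin F y & x @ \oo --> y.
Proof.
move=> cF z0Z cvx liminf.
have [k|m mP] := @choice nat nat (fun k m => (k <= m)%N /\ F (x m) < F z0 + k.+1%:R^-1).
  by have [|l kl Fl] := liminf k.+1%:R^-1 _ k; [rewrite invr_gt0|exists l].
have [b xb] : exists b, forall n, dot (x n - z0) (x n - z0) <= b.
  have [M [_ sM]] := cvg_seq_bounded (cvx _ z0Z).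
  exists (M + 1) => n; have /= h := sM (M + 1) _ n I.
  by apply: le_trans (ler_norm _) (h _); rewrite ltrDl.
(* A coordinate at squared distance at most b from z0 is at distance at most
   b + 1, which avoids a square root. *)
pose A := [set v : 'rV[R]_N | forall i, [set` `[z0 0 i - (b + 1), z0 0 i + (b + 1)]] (v ord0 i)].
have cA : compact A.
  exact: (@rV_compact R N (fun i => [set` `[z0 0 i - (b + 1), z0 0 i + (b + 1)]])
    (fun i => @segment_compact R _ _)).
have Ax n : A (x n).
  move=> i /=; rewrite in_itv /= -[ord0]/(0 : 'I_1).
  have := le_trans (sqr_coord_le (x n - z0) i) (xb n); rewrite !mxE.
  move: (x n 0 i) (z0 0 i) => r s rs.
  have b0 : 0 <= b by apply: le_trans rs; exact: sqr_ge0.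
  by apply/andP; split; nra.
have Axm : ((x \o m) @ \oo) A by exists 0%N => // k _ /=; exact: Ax.
have [a [_ acl]] := cA _ (fmap_proper_filter (x \o m) _) Axm.
have key (U : set 'rV[R]_N) K : nbhs a U -> exists2 k, (K <= k)%N & U (x (m k)).
  move=> aU; have [|_ [[k /= Kk <-] Uk]] := acl [set x (m k) | k in [set k | (K <= k)%N]] U _ aU.
    by exists K => // k /= Kk; exists k.
  by exists k.
have aZ : argmin F a.
  move=> y; apply: le_trans (z0Z y); rewrite leNgt; apply/negP => Fa.
  have [e e0 eE] : exists2 e, 0 < e & e = (F a - F z0) / 2.
    by exists ((F a - F z0) / 2) => //; rewrite divr_gt0// subr_gt0.
  have [K _ Ke] : \forall k \near \oo, k.+1%:R^-1 < e by exact: near_infty_natSinv_lt (PosNum e0).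
  have [|k Kk Fk] := key (F @^-1` [set r | F z0 + e < r]) K.
    apply: cF; by apply: lt_nbhsr; rewrite eE; lra.
  have := lt_trans Fk (mP k).2.
  by rewrite ltrD2l => /lt_trans/(_ (Ke k Kk)); rewrite ltxx.
exists a => //.
have /cvg_ex[l /= xl] := cvx _ aZ.
have l0 : 0 <= l.
  rewrite -(cvg_lim _ xl)//; apply: limr_ge; first by apply/cvg_ex; exists l.
  by apply: nearW => n; exact: dot_ge0.
have l_eq0 : l = 0.
  apply/eqP; rewrite eq_le l0 andbT leNgt; apply/negP => l_gt0.
  have [K _ Kl] : \forall n \near \oo, l / 2 < dot (x n - a) (x n - a).
    by apply: (cvgr_gt _ xl); lra.
  have [|k Kk kl] := key (fun y => dot (y - a) (y - a) < l / 2) K.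
    apply: (@continuous_sqdot _ _ a a [set r | r < l / 2]).
    by apply: lt_nbhsl; rewrite subrr dot0l; lra.
  by have := Kl (m k) (leq_trans Kk (mP k).1); move: kl => /=; lra.
apply/cvg_ballP => e e0.
have : \forall n \near \oo, dot (x n - a) (x n - a) < e ^+ 2.
  by apply: (cvgr_lt _ xl); rewrite l_eq0 exprn_gt0.
apply: filterS => n xe; split => // i k; rewrite ord1 /ball /=.
have := le_lt_trans (sqr_coord_le (x n - a) k) xe; rewrite !mxE ltr_norml.
move: e e0 {xe} (a 0 k) (x n 0 k) => e e0 r s rs.
by apply/andP; split; nra.
Qed.

(** * Borel sets and random vectors *)

Section borel_sets.
Context {R : realType} {N : nat}.

Lemma borel_open (B : set 'rV[R]_N) : open B -> borel B.
Proof. by move=> oB; exact: sub_sigma_algebra. Qed.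

Lemma borel_preimage (A : 'rV[R]_N -> 'rV[R]_N) (B : set 'rV[R]_N) :
  continuous A -> borel B -> borel (A @^-1` B).
Proof.
move=> cA; pose VT := g_sigma_algebraType [set B : set 'rV[R]_N | open B].
suff mA : measurable_fun setT (A : VT -> VT).
  by move=> bB; have := mA measurableT B bB; rewrite setTI.
apply: (@measurability _ _ VT VT setT A [set B : set 'rV[R]_N | open B] erefl) => _ [C oC <-].
by rewrite setTI; apply: borel_open; move/continuousP : cA; exact.
Qed.

Lemma borel_preimage_real (h : 'rV[R]_N -> R) (B : set R) :
  continuous h -> measurable B -> borel (h @^-1` B).
Proof.
move=> ch; pose VT := g_sigma_algebraType [set B : set 'rV[R]_N | open B].
suff mh : measurable_fun setT (h : VT -> R).
  by move=> bB; have := mh measurableT B bB; rewrite setTI.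
apply: (measurability _ (RGenOInfty.measurableE R)) => // _ [_ [r ->] <-].
rewrite setTI; apply: borel_open; move/continuousP : ch; apply.
exact: interval_open.
Qed.

End borel_sets.

Section random_vectors.
Context {R : realType} {N : nat} d (T : measurableType d).
Implicit Types (x y : T -> 'rV[R]_N).

Lemma random_vector_real x (h : 'rV[R]_N -> R) :
  random_vector x -> continuous h -> measurable_fun setT (fun w => h (x w)).
Proof.
by move=> mx ch _ B mB; rewrite setTI; apply: (mx (h @^-1` B)); exact: borel_preimage_real.
Qed.

Lemma random_vector_comp x (A : 'rV[R]_N -> 'rV[R]_N) :
  random_vector x -> continuous A -> random_vector (A \o x).
Proof. by move=> mx cA B bB; apply: (mx (A @^-1` B)); exact: borel_preimage. Qed.

Lemma random_vector_ae (P : probability T R) x y : measure_is_complete P ->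
  {ae P, forall w, x w = y w} -> random_vector x -> random_vector y.
Proof.
move=> cP [Z [mZ Z0 xy]] mx B bB.
have xyE w : ~ Z w -> x w = y w by move=> nZ; apply: contrapT => /xy.
have -> : y @^-1` B = (x @^-1` B `&` ~` Z) `|` (y @^-1` B `&` Z).
  apply/seteqP; split => w /=.
    by case: (pselect (Z w)) => [|nZ]; [right|left; rewrite xyE].
  by move=> [[+ nZ]|[]//]; rewrite xyE.
apply: measurableU; first by apply: measurableI; [exact: mx|exact: measurableC].
by apply: cP; exists Z; split => // w [].
Qed.

Lemma random_vector_cases (K : finType) (Y : T -> K) (y : K -> T -> 'rV[R]_N) :
  (forall k, measurable (Y @^-1` [set k])) -> (forall k, random_vector (y k)) ->
  random_vector (fun w => y (Y w) w).
Proof.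
move=> mY my B bB.
rewrite (_ : _ @^-1` B = \bigcup_(k in [set: K]) (Y @^-1` [set k] `&` y k @^-1` B)).
  by apply: fin_bigcup_measurable => // k _; apply: measurableI => //; exact: my.
apply/seteqP; split => w /=; first by exists (Y w).
by move=> [k _ /= [<-]].
Qed.

(** A closed set [C] is the intersection of its open neighbourhoods [U m] of
    radius [m.+1%:R^-1], so the limit lies in [C] exactly when the sequence is
    eventually in every [U m]. *)
Lemma random_vector_lim x (xn : nat -> T -> 'rV[R]_N) :
  (forall n, random_vector (xn n)) -> (forall w, xn ^~ w @ \oo --> x w) ->
  random_vector x.
Proof.
move=> mxn xnx.
suff mx (C : set 'rV[R]_N) : closed C -> measurable (x @^-1` C).
  have bS : @borel R N `<=` [set B | measurable (x @^-1` B)].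
    apply: smallest_sub; last first.
      move=> B oB /=; rewrite -[B]setCK preimage_setC; apply: measurableC.
      exact: (mx _ (open_closedC oB)).
    split => /=.
    - by rewrite preimage_set0.
    - by move=> A mA; rewrite setTD preimage_setC; exact: measurableC.
    - by move=> F mF; rewrite preimage_bigcup; exact: bigcupT_measurable.
  exact: bS.
move=> cC; pose U m := interior (\bigcup_(c in C) ball c m.+1%:R^-1).
rewrite (_ : x @^-1` C =
    \bigcap_m \bigcup_n \bigcap_(k in [set k | (n <= k)%N]) (xn k @^-1` U m)).
  apply: bigcapT_measurable => m; apply: bigcupT_measurable => n.
  apply: bigcap_measurable => [|k _]; first by exists n => /=.
  by apply: mxn; apply: borel_open; exact: open_interior.
apply/seteqP; split => w /=.
  move=> Cx m _.
  have xU : nbhs (x w) (U m).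
    apply: nbhs_interior.
    have m0 : (0 : R) < m.+1%:R^-1 by rewrite invr_gt0.
    by apply: filterS (nbhsx_ballx (x w) _ m0) => y xy; exists (x w).
  by have [n _ Un] := xnx w (U m) xU; exists n => // k /= nk; exact: Un.
move=> h; rewrite ((closure_id C).1 cC) => V.
move=> /nbhs_ballP[e /= e0 eV].
have [m me] : exists m, m.+1%:R^-1 < e / 2.
  have [m _ me] := near_infty_natSinv_lt (PosNum (divr_gt0 e0 (ltr0Sn R 1))).
  by exists m; exact: (me m (leqnn m)).
have [n _ Un] := h m I.
have xB : nbhs (x w) (ball (x w) (e / 2)) by apply: nbhsx_ballx; rewrite divr_gt0.
have [l _ Bl] := xnx w _ xB.
have [c Cc cx] := interior_subset (Un _ (leq_maxl n l)).
exists c; split => //; apply: eV; apply: (@ball_split _ _ (xn (maxn n l) w)).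
  exact: (Bl _ (leq_maxr n l)).
by apply: ball_sym; apply: le_ball cx; exact: ltW.
Qed.

End random_vectors.

(** * Independence from a generated sigma-algebra *)

Lemma ge0_integral_mrestr {R : realType} d (T : measurableType d)
    (mu : {measure set T -> \bar R}) (A B : set T) (mB : measurable B)
    (h : T -> \bar R) :
  measurable A -> measurable_fun setT h -> (forall w, 0 <= h w)%E ->
  (\int[mrestr mu mB]_(w in A) h w = \int[mu]_(w in A `&` B) h w)%E.
Proof.
move=> mA mh h0.
have mAB : measurable (A `&` B) by exact: measurableI.
have mADB : measurable (A `\` B) by exact: measurableD.
rewrite -{1}(setUIDK A B) ge0_integral_setU//.
- rewrite [X in (_ + X)%E](_ : _ = 0%E) ?adde0.
    apply: eq_measure_integral => C mC CAB; rewrite /= /mrestr; congr (mu _).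
    by apply/setIidPl => w /CAB[].
  apply: null_set_integral => //; first exact: measurable_funTS.
  by rewrite /= /mrestr setDKI measure0.
- by rewrite setUIDK; exact: measurable_funTS.
- by apply/disj_set2P; apply/seteqP; split => // w [[_ Bw] [_ /(_ Bw)]].
Qed.

(** Measurability with respect to the sigma-algebra generated by [G] is expressed
    by typing a function on [g_sigma_algebraType G], which is a copy of [T]. *)
Section independence.
Context {R : realType} d (T : measurableType d) (P : probability T R).
Variable G : set (set T).
Hypothesis GT : G `<=` measurable.
Local Notation FT := (g_sigma_algebraType G).

Lemma sub_sigma_measurable (A : set T) : <<s G >> A -> measurable A.
Proof.
apply: smallest_sub => //; split => //; last exact: bigcupT_measurable.
by move=> B mB; rewrite setTD; exact: measurableC.
Qed.

Lemma measurable_sub_sigma d' (U : measurableType d') (h : FT -> U) :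
  measurable_fun setT h -> measurable_fun setT (h : T -> U).
Proof. by move=> mh _ B mB; apply: sub_sigma_measurable; exact: mh. Qed.

(** Both sides are integrals over the coarser space, with respect to the images
    of [mu] and [nu] under the identity; these two image measures coincide. *)
Lemma ge0_integral_sub_sigma (mu nu : {measure set T -> \bar R}) (A : set T)
    (h : FT -> \bar R) :
  (forall C, <<s G >> C -> mu C = nu C) -> <<s G >> A ->
  measurable_fun setT h -> (forall w, 0 <= h w)%E ->
  (\int[mu]_(w in A) h w = \int[nu]_(w in A) h w)%E.
Proof.
move=> munu FA mh h0.
have mid : measurable_fun setT (fun w : T => w : FT).
  by move=> _ C FC; rewrite setTI; exact: sub_sigma_measurable.
have pf (m : {measure set T -> \bar R}) := @ge0_integral_pushforward _ _ _ _ _ _ mid m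
  A h FA (measurable_funTS mh) (fun w _ => h0 w).
rewrite preimage_id in pf; rewrite -!pf.
by apply: eq_measure_integral => C FC _; exact: munu.
Qed.

(** Independence says that the restriction of [P] to [B] and the multiple [P B]
    of [P] agree on the sigma-algebra of [h]. *)
Lemma integral_indep_event (A B : set T) (h : FT -> \bar R) :
  <<s G >> A -> measurable B ->
  (forall C, <<s G >> C -> P (C `&` B) = (P C * P B)%E) ->
  measurable_fun setT h -> (forall w, 0 <= h w)%E ->
  (\int[P]_(w in A `&` B) h w = P B * \int[P]_(w in A) h w)%E.
Proof.
move=> FA mB indep mh h0.
have mA := sub_sigma_measurable FA.
have mhT := measurable_sub_sigma mh.
have PB0 : P B \is a fin_num by exact: fin_num_measure.
have PBnn : (0 <= fine (P B))%R by rewrite fine_ge0.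
rewrite -(ge0_integral_mrestr P mB)//.
rewrite (@ge0_integral_sub_sigma _ (mscale (NngNum PBnn) P))//.
  by rewrite ge0_integral_mscale//= ?fineK//; exact: measurable_funTS.
by move=> C FC; rewrite /= /mscale /mrestr /= indep// fineK// muleC.
Qed.

(** Split according to the value [k] of [Y]: the integral of [h k] over the event
    [Y = k] factors by independence, with the same weight for every [k]. *)
Lemma integral_indep_uniform (K : finType) (Y : T -> K) (A : set T)
    (h : K -> FT -> \bar R) :
  <<s G >> A -> uniform_rv P Y -> independent_of P Y <<s G >> ->
  (forall k, measurable_fun setT (h k)) -> (forall k w, 0 <= h k w)%E ->
  (\int[P]_(w in A) h (Y w) w =
   \int[P]_(w in A) (#|K|%:R^-1%:E * \sum_(k : K) h k w))%E.
Proof.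
move=> FA [mY PY] indep mh h0.
have mA := sub_sigma_measurable FA.
have mhT k := measurable_sub_sigma (mh k).
have mYk k : measurable (Y @^-1` [set k]) by exact: mY.
rewrite ge0_integralZl//; last 2 first.
- by apply: emeasurable_sum => k; exact: measurable_funTS.
- by move=> w _; exact: sume_ge0.
rewrite ge0_integral_sum//; last by move=> k; exact: measurable_funTS.
rewrite ge0_sume_distrr; last by move=> k _; exact: integral_ge0.
pose g k := (h k : T -> \bar R) \_ (Y @^-1` [set k]).
have gE w : h (Y w) w = (\sum_(k : K) g k w)%E.
  rewrite (bigD1 (Y w)) //= big1 ?adde0.
    by rewrite /g patchE mem_set.
  by move=> k kY; rewrite /g patchE memNset// => /eqP; rewrite eq_sym (negPf kY).
under eq_integral do rewrite gE.
rewrite ge0_integral_sum//.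
- apply: eq_bigr => k _; rewrite -(PY k) -integral_indep_event//.
    by rewrite [RHS]integral_mkcondr.
  by move=> C FC; apply: indep.
- move=> k; apply: measurable_funTS; apply/(measurable_restrictT _ (mYk k)).
  exact: measurable_funTS.
- by move=> k w _; rewrite /g patchE; case: ifP.
Qed.

End independence.

Lemma measurable_fun_mono (T : pointedType) (G H : set (set T)) d'
    (U : measurableType d') (h : T -> U) :
  G `<=` H -> measurable_fun setT (h : g_sigma_algebraType G -> U) ->
  measurable_fun setT (h : g_sigma_algebraType H -> U).
Proof. by move=> GH mh _ B mB; apply: sub_sigma_algebra2 GH _ _; exact: mh. Qed.

(** * Doob maximal inequality and martingale convergence *)

Section maximal_inequality.
Context {R : realType} d (T : measurableType d) (P : probability T R).
Variable G : nat -> set (set T).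
Hypothesis GT : forall n, G n `<=` measurable.
Hypothesis Gnd : forall n, G n `<=` G n.+1.
Local Notation FT n := (g_sigma_algebraType (G n)).
Variable S : nat -> T -> R.
Hypothesis S0 : forall n w, 0 <= S n w.
Hypothesis mS : forall n, measurable_fun setT (S n : FT n -> R).
Hypothesis subS : forall n A, <<s G n >> A ->
  (\int[P]_(w in A) (S n w)%:E <= \int[P]_(w in A) (S n.+1 w)%:E)%E.

(** Proved for the integral over the union [U] of the events only, which makes it
    inductive: going from [n] to [n.+1], the submartingale property [subS]
    applies on [U], and on the rest of the new event [S n.+1] is at least [e].
    The process is nonnegative and its submartingale property is stated event by
    event, so that all integrals exist without integrability conditions. *)
Lemma doob_maximal (e : R) (n : nat) : 0 < e ->
  (e%:E * P (\big[setU/set0]_(k < n.+1) [set w | (e <= S k w)%R])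
     <= \int[P]_w (S n w)%:E)%E.
Proof.
move=> e0.
have mST k : measurable_fun setT (fun w => (S k w)%:E).
  have mSk : measurable_fun setT (S k : T -> R) := measurable_sub_sigma (@GT k) (@mS k).
  exact/measurable_EFinP.
pose V k := [set w | (e <= S k w)%R].
have FV k : <<s G k >> (V k).
  have -> : V k = [set: FT k] `&` (S k @^-1` `[e, +oo[%classic).
    by rewrite setTI; apply/seteqP; split => w /=; rewrite in_itv/= andbT.
  by apply: mS.
have mV k : measurable (V k) by exact: sub_sigma_measurable (@GT k) _ (FV k).
suff [FU] : <<s G n >> (\big[setU/set0]_(k < n.+1) V k) /\
    (e%:E * P (\big[setU/set0]_(k < n.+1) V k) <=
     \int[P]_(w in \big[setU/set0]_(k < n.+1) V k) (S n w)%:E)%E.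
  move/le_trans; apply; apply: ge0_subset_integral => //.
    exact: sub_sigma_measurable (@GT n) _ FU.
  by move=> w _; rewrite lee_fin.
have base k A : measurable A -> A `<=` V k ->
    (e%:E * P A <= \int[P]_(w in A) (S k w)%:E)%E.
  move=> mA AV; rewrite -integral_cst//; apply: ge0_le_integral => //.
    by move=> w _; rewrite lee_fin ltW.
  exact: measurable_funTS.
elim: n => [|n IHn]; last have [FU IH] := IHn.
  by rewrite big_ord1; split; [exact: FV|exact: base].
rewrite big_ord_recr /=; set U := \big[_/_]_(_ < _) _ in FU IH *.
have FU' : <<s G n.+1 >> U by exact: sub_sigma_algebra2 (@Gnd n) _ FU.
have mU := sub_sigma_measurable (@GT n) FU.
have mD : measurable (V n.+1 `\` U) by exact: measurableD.
split; first by apply: (@measurableU _ (FT n.+1)); [exact: FU'|exact: FV].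
have dU : [disjoint U & V n.+1 `\` U].
  by apply/disj_set2P; rewrite setDIK.
have -> : U `|` V n.+1 = U `|` (V n.+1 `\` U).
  by rewrite setUDr setDv setD0.
rewrite ge0_integral_setU//; last 2 first.
- exact: measurable_funTS.
- by move=> w _; rewrite lee_fin.
rewrite measureU//; last by rewrite setDIK.
rewrite ge0_muleDr//; apply: leeD.
  by apply: le_trans IH _; exact: subS.
by apply: base => //; exact: subDsetl.
Qed.

End maximal_inequality.

Section martingale_convergence.
Context {R : realType} d (T : measurableType d) (P : probability T R).
Variable G : nat -> set (set T).
Hypothesis GT : forall n, G n `<=` measurable.
Hypothesis Gnd : forall m n, (m <= n)%N -> G m `<=` G n.
Local Notation FT n := (g_sigma_algebraType (G n)).
Variables (M : nat -> T -> R) (c : nat -> R).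
Hypothesis mM : forall n, measurable_fun setT (M n : FT n -> R).
Hypothesis c0 : forall n, 0 <= c n.
Hypothesis cvgc : cvgn (series c).
Hypothesis M_sub : forall m n A, (m <= n)%N -> <<s G n >> A ->
  (\int[P]_(w in A) ((M n w - M m w) ^+ 2)%:E <=
   \int[P]_(w in A) ((M n.+1 w - M m w) ^+ 2)%:E)%E.
Hypothesis M_var : forall m n, (m <= n)%N ->
  (\int[P]_w ((M n.+1 w - M m w) ^+ 2)%:E <=
   \int[P]_w ((M n w - M m w) ^+ 2)%:E + (c n)%:E)%E.

Let tail m := limn (series c) - series c m.

Let variance_tail m n :
  (\int[P]_w ((M (m + n)%N w - M m w) ^+ 2)%:E <= (tail m)%:E)%E.
Proof.
apply: (@le_trans _ _ (series c (m + n)%N - series c m)%:E).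
  elim: n => [|n IHn].
    by rewrite addn0 subrr; under eq_integral do rewrite subrr expr0n /=; rewrite integral0.
  rewrite addnS; apply: (le_trans (M_var (leq_addr n m))).
  by rewrite seriesSr -addrA addrAC addrA EFinD leeD2r.
rewrite lee_fin lerD2r; apply: nondecreasing_cvgn_le => //.
by apply/nondecreasing_seqP => k; rewrite seriesSr lerDl.
Qed.

Let excursion (e : R) m := \bigcup_k [set w | e ^+ 2 <= (M (m + k)%N w - M m w) ^+ 2].

Let measurable_sqr m k :
  measurable_fun setT ((fun w => (M (m + k)%N w - M m w) ^+ 2) : FT (m + k) -> R).
Proof.
have h : measurable_fun setT (M m : FT (m + k) -> R).
  exact: measurable_fun_mono (Gnd (leq_addr k m)) (@mM m).
by apply: measurable_funX; exact: measurable_funB.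
Qed.

Let measurable_event (e : R) m k : measurable [set w | e ^+ 2 <= (M (m + k)%N w - M m w) ^+ 2].
Proof.
rewrite -[X in measurable X]setTI.
rewrite (_ : [set w | _] = (fun w => (M (m + k)%N w - M m w) ^+ 2) @^-1` `[e ^+ 2, +oo[%classic).
  have mf := measurable_sub_sigma (@GT (m + k)%N) (@measurable_sqr m k).
  exact: mf.
by apply/seteqP; split => w /=; rewrite in_itv/= andbT.
Qed.

(** Doob's inequality for the squares of the increments of [M] after time [m],
    passing to the limit in the number of increments. *)
Let excursion_small (e : R) m : 0 < e ->
  ((e ^+ 2)%:E * P (excursion e m) <= (tail m)%:E)%E.
Proof.
move=> e0; pose V n := \big[setU/set0]_(k < n.+1)
  [set w | e ^+ 2 <= (M (m + k)%N w - M m w) ^+ 2].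
have mV n : measurable (V n) by apply: bigsetU_measurable => k _.
have ndV : nondecreasing_seq V.
  move=> i j ij; apply/subsetPset.
  by apply: (@subset_bigsetU _
    (fun k => [set w | e ^+ 2 <= (M (m + k)%N w - M m w) ^+ 2]) i.+1 j.+1).
have VE : \bigcup_n V n = excursion e m.
  exact: bigcup_bigsetU_bigcup.
rewrite -VE.
have cv := nondecreasing_cvg_mu (mu := P) mV (bigcupT_measurable _ mV) ndV.
rewrite -(cvg_lim _ cv)// -limeMl//; last by apply/cvg_ex; eexists; exact: cv.
apply: lime_le.
  apply: is_cvgeZl => //; apply/cvg_ex; eexists; exact: cv.
apply: nearW => n /=; apply: le_trans (variance_tail m n).
apply: (@doob_maximal _ _ _ P (fun k => G (m + k)%N) _ _ (fun k w => (M (m + k)%N w - M m w) ^+ 2)).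
- by move=> k; exact: GT.
- by move=> k; apply: Gnd; rewrite addnS.
- by move=> k w; exact: sqr_ge0.
- by move=> k; exact: measurable_sqr.
- by move=> k A FA; rewrite addnS; apply: M_sub => //; exact: leq_addr.
- by rewrite exprn_gt0.
Qed.

Let excursion_negligible (e : R) : 0 < e -> P.-negligible (\bigcap_m excursion e m).
Proof.
move=> e0.
have mE m : measurable (excursion e m) by apply: bigcupT_measurable => k.
have mI : measurable (\bigcap_m excursion e m) by exact: bigcapT_measurable.
apply/negligibleP => //; apply/eqP; rewrite eq_le measure_ge0 andbT.
have e2 : 0 < e ^+ 2 by rewrite exprn_gt0.
rewrite -(@lee_pmul2l _ (e ^+ 2)%:E) ?lte_fin// mule0.
have tail0 : (tail m)%:E @[m --> \oo] --> (0 : \bar R).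
  apply: cvg_EFin; first by apply: nearW.
  rewrite /= -(subrr (limn (series c))).
  by apply: cvgB; [exact: cvg_cst|exact: cvgc].
rewrite -(cvg_lim _ tail0)//; apply: lime_ge; first by apply/cvg_ex; eexists; exact: tail0.
apply: nearW => m; apply: le_trans (excursion_small m e0).
rewrite lee_pmul2l ?lte_fin//; apply: le_measure; rewrite ?inE//.
exact: bigcap_inf.
Qed.

(** The probability that [M] moves by [e] or more after time [m] is at most
    [tail m / e ^+ 2], so almost surely [M] is a Cauchy sequence.  The martingale
    property enters only through [M_sub] and [M_var], which compare integrals of
    squares. *)
Lemma martingale_cvg : {ae P, forall w, cvgn (fun n => M n w)}.
Proof.
apply: (@negligibleS _ _ _ _ (\bigcup_j \bigcap_m excursion j.+1%:R^-1 m)); last first.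
  by apply: negligible_bigcup => j; apply: excursion_negligible; rewrite invr_gt0.
move=> w /= ncv; apply: contrapT => nex; apply: ncv.
apply/cauchy_cvgP; apply: cauchy_exP => e e0.
have [j je] : exists j, j.+1%:R^-1 < e.
  have [j _ je] := near_infty_natSinv_lt (PosNum e0).
  by exists j; exact: (je j (leqnn j)).
have [m nm] : exists m, ~ excursion j.+1%:R^-1 m w.
  by apply: contrapT => /forallNP h; apply: nex; exists j => // m _; apply: contrapT.
exists (M m w); exists m => // n /= mn.
have {nm} : ~ (j.+1%:R^-1 ^+ 2 <= (M n w - M m w) ^+ 2).
  by move=> h; apply: nm; exists (n - m)%N => //=; rewrite subnKC.
move/negP; rewrite -ltNge /ball /= => h; apply: lt_trans je.
rewrite distrC -ltr_sqr ?nnegrE ?normr_ge0 ?invr_ge0//.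
by rewrite real_normK// num_real.
Qed.

End martingale_convergence.

(** * Averages over a finite set *)

Section average.
Context {R : realType} (K : finType).
Hypothesis K_gt0 : (0 < #|K|)%N.
Implicit Types (b : K -> R).

Definition avg b : R := #|K|%:R^-1 * \sum_(k : K) b k.

Lemma avg_cst (a : R) : avg (fun _ => a) = a.
Proof.
by rewrite /avg sumr_const -[a *+ _]mulr_natr mulrCA mulVf ?mulr1// pnatr_eq0 -lt0n.
Qed.

Lemma avgD b b' : avg (fun k => b k + b' k) = avg b + avg b'.
Proof. by rewrite /avg big_split mulrDr. Qed.

Lemma avgZ (a : R) b : avg (fun k => a * b k) = a * avg b.
Proof. by rewrite /avg -mulr_sumr mulrCA. Qed.

Lemma le_avg b b' : (forall k, b k <= b' k) -> avg b <= avg b'.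
Proof. by move=> bb'; rewrite /avg ler_wpM2l ?invr_ge0// ler_sum. Qed.

Lemma avg_ge0 b : (forall k, 0 <= b k) -> 0 <= avg b.
Proof. by move=> b0; rewrite -(avg_cst 0); exact: le_avg. Qed.

Let avg_sqr_expand (a : R) b :
  avg (fun k => (a + b k) ^+ 2) = a ^+ 2 + 2 * a * avg b + avg (fun k => b k ^+ 2).
Proof.
rewrite -{1}(avg_cst (a ^+ 2)) -avgZ -!avgD; congr avg.
by apply/funext => k; ring.
Qed.

(** The two bounds below come from the same bias-variance expansion; the centre
    [avg b] is the one that kills the cross term with [a] and minimizes the
    variance term. *)
Lemma avg_centered_ge (a : R) b : a ^+ 2 <= avg (fun k => (a + (b k - avg b)) ^+ 2).
Proof.
rewrite avg_sqr_expand avgD avg_cst subrr mulr0 addr0 lerDl.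
by apply: avg_ge0 => k; exact: sqr_ge0.
Qed.

Lemma avg_centered_le (a c : R) b :
  avg (fun k => (a + (b k - avg b)) ^+ 2) <= a ^+ 2 + avg (fun k => (b k - c) ^+ 2).
Proof.
rewrite avg_sqr_expand avgD avg_cst subrr mulr0 addr0 lerD2l.
have e r : (fun k => (b k - r) ^+ 2) = (fun k => (- r + b k) ^+ 2).
  by apply/funext => k; rewrite addrC.
rewrite !e !avg_sqr_expand; have := sqr_ge0 (avg b - c); nra.
Qed.

End average.

Lemma avg_prod {R : realType} (K1 K2 : finType) (a : K1 -> R) (b : K2 -> R) :
  (0 < #|K1|)%N -> (0 < #|K2|)%N ->
  avg (fun k : K1 * K2 => a k.1 + b k.2) = avg a + avg b.
Proof.
move=> K1_gt0 K2_gt0.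
rewrite /avg.
have -> : \sum_(k : K1 * K2) (a k.1 + b k.2) = \sum_i \sum_j (a i + b j).
  by rewrite pair_bigA.
under eq_bigr do rewrite big_split sumr_const -[_ *+ _]mulr_natr /=.
rewrite big_split /= -mulr_suml sumr_const -[_ *+ _]mulr_natr card_prod natrM.
by field; rewrite !pnatr_eq0 -!lt0n K1_gt0 K2_gt0.
Qed.

(** * Random iterations driven by independent uniform indices *)

Section random_iteration.
Context {R : realType} {N : nat} d (T : measurableType d) (P : probability T R).
Variables (K : finType) (x : nat -> T -> 'rV[R]_N) (Y : nat -> T -> K).
Variable step : nat -> K -> 'rV[R]_N -> 'rV[R]_N.
Hypothesis K_gt0 : (0 < #|K|)%N.
Hypothesis cP : measure_is_complete P.
Hypothesis mx0 : random_vector (x 0).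
Hypothesis step_cont : forall n k, continuous (step n k).
Hypothesis xS : forall n, {ae P, forall w, x n.+1 w = step n (Y n w) (x n w)}.
Hypothesis uY : forall n, uniform_rv P (Y n).
Hypothesis iY : forall n, independent_of P (Y n) (sigma_upto x n).

Lemma random_vector_iter n : random_vector (x n).
Proof.
elim: n => [//|n IHn].
apply: (random_vector_ae cP (x := fun w => step n (Y n w) (x n w))).
  by apply: filterS (xS n) => w ->.
apply: (@random_vector_cases _ _ _ _ _ (Y n) (fun k w => step n k (x n w))) => k.
  exact: (uY n).1.
exact: random_vector_comp.
Qed.

(** The sigma-algebra generated by [past n] is [sigma_upto x n]. *)
Definition past n := \bigcup_(k in [set k | (k <= n)%N])
  preimage_set_system setT (x k) (@borel R N).

Local Notation FT n := (g_sigma_algebraType (past n)).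

Lemma past_measurable n : past n `<=` measurable.
Proof.
by move=> A [k _ [B bB <-]]; rewrite setTI; exact: random_vector_iter.
Qed.

Lemma past_mono m n : (m <= n)%N -> past m `<=` past n.
Proof. by move=> mn A [k /= km AB]; exists k => //=; exact: leq_trans mn. Qed.

Lemma measurable_past n k (h : 'rV[R]_N -> R) : (k <= n)%N -> continuous h ->
  measurable_fun setT ((fun w => h (x k w)) : FT n -> R).
Proof.
move=> kn ch _ B mB; rewrite setTI; apply: sub_sigma_algebra.
exists k => //; exists (h @^-1` B); first exact: borel_preimage_real.
by rewrite setTI.
Qed.

Lemma measurable_iter n (h : 'rV[R]_N -> R) : continuous h ->
  measurable_fun setT (fun w => h (x n w)).
Proof. by move=> ch; apply: random_vector_real => //; exact: random_vector_iter. Qed.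

(** This identity replaces the computation of a conditional expectation given the
    past: the drawn index is averaged out.  The first argument of [q] lets the
    integrand depend on the whole past besides the new iterate. *)
Lemma integral_step n (A : set T) (q : T -> 'rV[R]_N -> R) :
  sigma_upto x n A ->
  (forall w y, 0 <= q w y) ->
  measurable_fun setT (fun w => q w (x n.+1 w)) ->
  (forall k, measurable_fun setT ((fun w => q w (step n k (x n w))) : FT n -> R)) ->
  (\int[P]_(w in A) (q w (x n.+1 w))%:E =
   \int[P]_(w in A) (avg (fun k => q w (step n k (x n w))))%:E)%E.
Proof.
move=> FA q0 mq mqk.
have mqkT k : measurable_fun setT (fun w : T => (q w (step n k (x n w)))%:E).
  apply/measurable_EFinP; exact: (measurable_sub_sigma (@past_measurable n) (mqk k)).
have mA : measurable A := sub_sigma_measurable (@past_measurable n) FA.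
have mYk k : measurable (Y n @^-1` [set k]) by exact: (uY n).1.
transitivity (\int[P]_(w in A) (q w (step n (Y n w) (x n w)))%:E)%E.
  apply: ge0_ae_eq_integral => //.
  - by apply: measurable_funTS; exact/measurable_EFinP.
  - apply: measurable_funTS => _ B mB; rewrite setTI.
    rewrite (_ : _ @^-1` B = \bigcup_(k in [set: K])
        (Y n @^-1` [set k] `&` (fun w => (q w (step n k (x n w)))%:E) @^-1` B)).
      apply: fin_bigcup_measurable => // k _; apply: measurableI => //.
      by rewrite -[X in measurable X]setTI; exact: mqkT.
    apply/seteqP; split => w /=; first by exists (Y n w).
    by move=> [k _ /= [<-]].
  - by move=> w _; rewrite lee_fin.
  - by move=> w _; rewrite lee_fin.
  - by apply: filterS (xS n) => w -> _.
rewrite (@integral_indep_uniform _ _ _ P (past n) (@past_measurable n) K (Y n) A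
  (fun k w => (q w (step n k (x n w)))%:E))//.
- by apply: eq_integral => w _; rewrite sumEFin -EFinM.
- by move=> k; exact/measurable_EFinP.
- by move=> k w; rewrite lee_fin.
Qed.

Section compensated_sum.
Variables (phi : 'rV[R]_N -> R) (c : nat -> R).
Hypothesis phi_cont : continuous phi.
Hypothesis c0 : forall n, 0 <= c n.
Hypothesis cvgc : cvgn (series c).
Hypothesis phi_var : forall n,
  (\int[P]_w (avg (fun k => (phi (step n k (x n w)) - phi (x n w)) ^+ 2))%:E
    <= (c n)%:E)%E.

Let mean n y := avg (fun k => phi (step n k y)).

Let continuous_phi_step n k : continuous (fun y => phi (step n k y)).
Proof.
move=> y; apply: (@continuous_comp _ _ _ (step n k) phi); first exact: step_cont.
exact: phi_cont.
Qed.

Let continuous_mean n : continuous (mean n).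
Proof.
apply: continuous_mul; first exact: continuous_cst.
by apply: continuous_sumr.
Qed.

(** The increment of [phi] along the iteration, compensated by its conditional
    expectation given [x n]. *)
Definition noise n w := phi (x n.+1 w) - avg (fun k => phi (step n k (x n w))).

Let M n w := series (noise ^~ w) n.

Let measurable_M m n : (m <= n)%N -> measurable_fun setT (M m : FT n -> R).
Proof.
move=> mn; rewrite /M /series /=.
rewrite (_ : (fun w => _) = (fun w => \sum_(k < m) noise k w)); last first.
  by apply/funext => w; rewrite big_mkord.
apply: measurable_sum => k; apply: measurable_funB.
  by apply: measurable_past => //; apply: leq_trans mn.
apply: (@measurable_past n k (mean k)) => //; apply: leq_trans mn.
exact: ltnW.
Qed.

Let increment m n (A : set T) : (m <= n)%N -> sigma_upto x n A ->
  (\int[P]_(w in A) ((M n.+1 w - M m w) ^+ 2)%:E =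
   \int[P]_(w in A) (avg (fun k => ((M n w - M m w) +
      (phi (step n k (x n w)) - mean n (x n w))) ^+ 2))%:E)%E.
Proof.
move=> mn FA.
rewrite -(@integral_step n A (fun w y => ((M n w - M m w) + (phi y - mean n (x n w))) ^+ 2))//.
- apply: eq_integral => w _; rewrite /M seriesSr /noise; congr (_ ^+ 2)%:E.
  by rewrite /mean; ring.
- by move=> w y; exact: sqr_ge0.
- have mMT k : measurable_fun setT (M k) :=
    measurable_sub_sigma (@past_measurable k) (measurable_M (leqnn k)).
  apply: measurable_funX; apply: measurable_funD; first exact: measurable_funB.
  by apply: measurable_funB; exact: measurable_iter.
- move=> k; apply: measurable_funX; apply: measurable_funD.
    by apply: measurable_funB; exact: measurable_M.
  apply: measurable_funB; last exact: measurable_past.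
  exact: (@measurable_past n n (fun y => phi (step n k y))).
Qed.

(** Partial sums of [noise] form a martingale for the filtration of the iterates,
    and [phi_var] bounds its conditional variances: the average is the constant
    closest in mean square to the values [phi (step n k y)], so the variance can
    only increase when it is replaced by [phi y]. *)
Lemma noise_series_cvg : {ae P, forall w, cvgn (series (noise ^~ w))}.
Proof.
have mMT k : measurable_fun setT (M k) :=
  measurable_sub_sigma (@past_measurable k) (measurable_M (leqnn k)).
have mdiff m n : measurable_fun setT (fun w => ((M n w - M m w) ^+ 2)%:E).
  apply/measurable_EFinP; apply: measurable_funX.
  exact: measurable_funB.
have mavg (h : K -> T -> R) : (forall k, measurable_fun setT (h k)) ->
    measurable_fun setT (fun w => (avg (h ^~ w))%:E).
  move=> mh; apply/measurable_EFinP; apply: measurable_funM => //.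
  exact: measurable_sum.
have mmean n : measurable_fun setT (fun w => mean n (x n w)).
  by apply: measurable_iter; exact: continuous_mean.
have mphi n : measurable_fun setT (fun w => phi (x n w)) by exact: measurable_iter.
have mstep n k : measurable_fun setT (fun w => phi (step n k (x n w))).
  by apply: (@measurable_iter n (fun y => phi (step n k y))); exact: continuous_phi_step.
have mcentered m n : measurable_fun setT (fun w => (avg (fun k => ((M n w - M m w) +
      (phi (step n k (x n w)) - mean n (x n w))) ^+ 2))%:E).
  apply: (mavg (fun k w => _)) => k; apply: measurable_funX.
  by apply: measurable_funD; exact: measurable_funB.
have mvar n : measurable_fun setT
    (fun w => (avg (fun k => (phi (step n k (x n w)) - phi (x n w)) ^+ 2))%:E).
  apply: (mavg (fun k w => _)) => k; apply: measurable_funX.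
  exact: measurable_funB.
apply: (@martingale_cvg _ _ _ P past past_measurable past_mono M c) => //.
- by move=> n; exact: measurable_M.
- move=> m n A mn FA; rewrite increment//.
  have mA : measurable A := sub_sigma_measurable (@past_measurable n) FA.
  apply: ge0_le_integral => //.
  + by move=> w _; rewrite lee_fin sqr_ge0.
  + exact: measurable_funTS.
  + exact: measurable_funTS.
  + by move=> w _; rewrite lee_fin avg_centered_ge.
- move=> m n mn; rewrite increment//; last exact: (@measurableT _ (FT n)).
  apply: (le_trans _ (leeD2l _ (phi_var n))).
  rewrite -ge0_integralD//; last 2 first.
  + by move=> w _; rewrite lee_fin sqr_ge0.
  + by move=> w _; rewrite lee_fin avg_ge0// => k; exact: sqr_ge0.
  apply: ge0_le_integral => //.
  + by move=> w _; rewrite lee_fin avg_ge0// => k; exact: sqr_ge0.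
  + exact: emeasurable_funD.
  + by move=> w _; rewrite -EFinD lee_fin avg_centered_le.
Qed.

End compensated_sum.
End random_iteration.

(** * Passing from moments and almost sure convergence to integrals *)

Section L1_convergence.
Context {R : realType} d (T : measurableType d) (P : probability T R).

Lemma integral_le_affine (f g : T -> R) (a b B : R) :
  measurable_fun setT f -> measurable_fun setT g ->
  (forall w, 0 <= f w) -> (forall w, 0 <= g w) -> 0 <= a -> 0 <= b ->
  (forall w, f w <= a * g w + b) -> (\int[P]_w (g w)%:E <= B%:E)%E ->
  (\int[P]_w (f w)%:E <= (a * B + b)%:E)%E.
Proof.
move=> mf mg f0 g0 a0 b0 fg gB.
have mfE : measurable_fun setT (fun w => (f w)%:E) by exact/measurable_EFinP.
have mgE : measurable_fun setT (fun w => (g w)%:E) by exact/measurable_EFinP.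
have magE : measurable_fun setT (fun w => a%:E * (g w)%:E)%E.
  by apply: emeasurable_funM => //; exact: measurable_cst.
apply: (@le_trans _ _ (\int[P]_w (a%:E * (g w)%:E + (cst b%:E) w))%E).
  apply: ge0_le_integral => //.
  - by move=> w _; rewrite lee_fin.
  - by apply: emeasurable_funD.
  - by move=> w _; rewrite -EFinM -EFinD lee_fin.
rewrite ge0_integralD//; last first.
  by move=> w _; rewrite -EFinM lee_fin mulr_ge0.
rewrite integral_cst//= ge0_integralZl ?lee_fin//; last first.
  by move=> w _; rewrite lee_fin.
rewrite EFinD EFinM; apply: leeD; first by rewrite lee_wpmul2l.
by rewrite [X in (_ * X)%E](probability_setT P) mule1.
Qed.

(** Truncation at level [r]: [e <= min e r + e ^+ 2 / r], where the first term
    is handled by bounded convergence and the second by the moment bound. *)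
Lemma L2_bounded_L1_cvg (e : nat -> T -> R) (B : R) :
  (forall n, measurable_fun setT (e n)) -> (forall n w, 0 <= e n w) ->
  {ae P, forall w, e ^~ w @ \oo --> (0 : R)} ->
  (forall n, \int[P]_w (e n w ^+ 2)%:E <= B%:E)%E ->
  (fun n => \int[P]_w (e n w)%:E)%E @ \oo --> 0%E.
Proof.
move=> me e0 ecvg eB.
have B0 : 0 <= B.
  rewrite -lee_fin; apply: le_trans (eB 0%N).
  by apply: integral_ge0 => w _; rewrite lee_fin sqr_ge0.
have mE n : measurable_fun setT (fun w => (e n w)%:E) by exact/measurable_EFinP.
have mmin r n : measurable_fun setT (fun w => (Num.min (e n w) r)%:E).
  by apply/measurable_EFinP; exact: measurable_minr.
have trunc r : 0 < r -> (fun n => \int[P]_w (Num.min (e n w) r)%:E)%E @ \oo --> 0%E.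
  move=> r0.
  have [|||||_ _] := @dominated_convergence _ _ _ P _ measurableT
    (fun n w => (Num.min (e n w) r)%:E) (fun=> 0%E) (fun=> r%:E).
  - exact: mmin.
  - exact: measurable_cst.
  - apply: filterS ecvg => w ew _; apply: cvg_EFin; first exact: nearW.
    apply: (squeeze_cvgr _ (cvg_cst (0 : R)) ew); apply: nearW => n /=.
    by rewrite le_min e0 (ltW r0) ge_min lexx.
  - exact: finite_measure_integrable_cst.
  - by apply: aeW => w n _; rewrite gee0_abs ?lee_fin ?ge_min ?lexx ?orbT// le_min e0 ltW.
  - by rewrite integral0.
have bound r n : 0 < r -> (\int[P]_w (e n w)%:E <=
    \int[P]_w (Num.min (e n w) r)%:E + (B / r)%:E)%E.
  move=> r0.
  have me2 : measurable_fun setT (fun w => (e n w ^+ 2)%:E).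
    by apply/measurable_EFinP; exact: measurable_funX.
  have -> : ((B / r)%:E = r^-1%:E * B%:E)%E by rewrite mulrC EFinM.
  apply: (@le_trans _ _ (\int[P]_w (Num.min (e n w) r)%:E
      + r^-1%:E * \int[P]_w (e n w ^+ 2)%:E)%E); last first.
    by rewrite leeD2l// lee_wpmul2l// lee_fin invr_ge0 ltW.
  rewrite -ge0_integralZl//; last 2 first.
  - by move=> w _; rewrite lee_fin sqr_ge0.
  - by rewrite lee_fin invr_ge0 ltW.
  have min0 w : 0 <= Num.min (e n w) r by rewrite le_min e0 ltW.
  rewrite -ge0_integralD//; last 3 first.
  - by move=> w _; rewrite lee_fin.
  - by move=> w _; rewrite -EFinM lee_fin mulr_ge0 ?invr_ge0 ?sqr_ge0 ?(ltW r0).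
  - by apply: emeasurable_funM => //; exact: measurable_cst.
  apply: ge0_le_integral => //.
  - by move=> w _; rewrite lee_fin.
  - by apply: emeasurable_funD => //; apply: emeasurable_funM => //; exact: measurable_cst.
  - move=> w _; rewrite -EFinM -EFinD lee_fin.
    have [er|re] := leP (e n w) r.
      by rewrite lerDl mulr_ge0 ?invr_ge0 ?sqr_ge0 ?(ltW r0).
    have h : 1 * e n w <= r^-1 * e n w * e n w.
      by rewrite ler_wpM2r// mulrC ler_pdivlMr// mul1r ltW.
    by rewrite expr2 mulrA -[leLHS]mul1r; apply: le_trans h _; rewrite lerDr ltW.
have ufin n : (\int[P]_w (e n w)%:E)%E \is a fin_num.
  rewrite ge0_fin_numE; last by apply: integral_ge0 => w _; rewrite lee_fin.
  apply: (le_lt_trans (bound 1 n ltr01)); rewrite lte_add_pinfty ?ltry//.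
  apply: (@le_lt_trans _ _ (\int[P]_w (cst 1%:E w))%E); last first.
    by rewrite integral_cst//= mul1e -ge0_fin_numE ?measure_ge0 ?fin_num_measure.
  apply: ge0_le_integral => //.
  - by move=> w _; rewrite lee_fin le_min e0 ler01.
  - by move=> w _; rewrite lee_fin ge_min lexx orbT.
apply/fine_cvgP; split; first exact: nearW.
apply/cvgrPdist_lt => eps eps0.
pose r := 2 * (B + 1) / eps.
have r0 : 0 < r by rewrite divr_gt0// mulr_gt0// ltr_wpDl.
have /fine_cvgP[vfin /cvgrPdist_lt /(_ (eps / 2)) vlt] := trunc r r0.
have := vlt (divr_gt0 eps0 (ltr0Sn _ 1)).
move: vfin; apply: filterS2 => n vn; rewrite /= !sub0r !normrN => vr.
have u0 : 0 <= fine (\int[P]_w (e n w)%:E)%E.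
  by apply: fine_ge0; apply: integral_ge0 => w _; rewrite lee_fin.
rewrite ger0_norm//.
have := bound r n r0; rewrite -[X in (X <= _)%E]fineK// -[X in (_ <= X + _)%E]fineK//.
rewrite -EFinD lee_fin => /le_lt_trans; apply.
have Br : B / r < eps / 2.
  by rewrite /r invf_div mulrA ltr_pdivrMr ?mulr_gt0 ?ltr_wpDl//; nra.
by have := ler_norm (fine (\int[P]_w (Num.min (e n w) r)%:E)%E); lra.
Qed.

Lemma fatou_cvg (e : nat -> T -> R) (e' : T -> R) (B : \bar R) :
  (forall n, measurable_fun setT (e n)) -> (forall n w, 0 <= e n w) ->
  (forall w, e ^~ w @ \oo --> e' w) ->
  (forall n, \int[P]_w (e n w)%:E <= B)%E ->
  (\int[P]_w (e' w)%:E <= B)%E.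
Proof.
move=> me e0 ecvg eB.
have mE n : measurable_fun setT (fun w => (e n w)%:E) by exact/measurable_EFinP.
have -> : (\int[P]_w (e' w)%:E = \int[P]_w limn_einf (fun n => (e n w)%:E))%E.
  apply: eq_integral => w _; apply/esym.
  have ewE : (e n w)%:E @[n --> \oo] --> (e' w)%:E.
    by apply: cvg_EFin; [exact: nearW|exact: ecvg].
  by rewrite (cvg_limn_einf_sup ewE).1.
have := @fatou _ _ _ P _ measurableT (fun n w => (e n w)%:E) mE.
move=> /(_ (fun n w _ => e0 n w))/le_trans; apply.
rewrite limn_einf_lim; apply: lime_le; first exact: is_cvg_einfs.
apply: nearW => n; apply: le_trans (eB n).
by apply: ereal_inf_lbound; exists n => /=.
Qed.

End L1_convergence.

(** * Stochastic quasi-Fejer iterations *)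

(** The forward-backward step enters the convergence argument through its
    continuity and the estimates [displacement] and [descent]; the formulas for
    the proximity operator and the gradient stay out of the probabilistic part. *)
Section stochastic_fejer.
Context {R : realType} {N : nat} d (T : measurableType d) (P : probability T R).
Variables (K : finType) (x : nat -> T -> 'rV[R]_N) (Y : nat -> T -> K).
Variables (step : nat -> K -> 'rV[R]_N -> 'rV[R]_N) (Phi : K -> 'rV[R]_N -> R).
Variables (gamma : nat -> R) (C : R).
Hypothesis K_gt0 : (0 < #|K|)%N.
Hypothesis cP : measure_is_complete P.
Hypothesis x0L2 : in_Lp P 2 (x 0).
Hypothesis step_cont : forall n k, continuous (step n k).
Hypothesis xS : forall n, {ae P, forall w, x n.+1 w = step n (Y n w) (x n w)}.
Hypothesis uY : forall n, uniform_rv P (Y n).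
Hypothesis iY : forall n, independent_of P (Y n) (sigma_upto x n).
Hypothesis Phi_cont : forall k, continuous (Phi k).
Hypothesis gamma_gt0 : forall n, 0 < gamma n.
Hypothesis gamma_sum : (\sum_(0 <= n <oo) (gamma n)%:E = +oo)%E.
Hypothesis gamma_sqr_sum : (\sum_(0 <= n <oo) (gamma n ^+ 2)%:E < +oo)%E.
Hypothesis C_ge0 : 0 <= C.
Hypothesis displacement : forall n k y,
  dot (step n k y - y) (step n k y - y) <= gamma n ^+ 2 * C.
Hypothesis descent : forall n k y z,
  dot (step n k y - z) (step n k y - z) <=
  dot (y - z) (y - z) - 2 * gamma n * (Phi k y - Phi k z) + gamma n ^+ 2 * C.

Let F y := avg (fun k => Phi k y).
Hypothesis Z_neq0 : argmin F !=set0.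

Let F_cont : continuous F.
Proof.
by apply: continuous_mul; [exact: continuous_cst|exact: continuous_sumr].
Qed.

Let mx0 : random_vector (x 0) := x0L2.1.

Let mx n : random_vector (x n).
Proof. exact: (random_vector_iter cP mx0 step_cont xS uY). Qed.

Let cvg_gamma_sqr : cvgn (series (fun n => gamma n ^+ 2)).
Proof.
have sfin : (\sum_(0 <= n <oo) (gamma n ^+ 2)%:E)%E \is a fin_num.
  rewrite ge0_fin_numE//; apply: nneseries_ge0 => n _ _.
  by rewrite lee_fin sqr_ge0.
apply: nondecreasing_is_cvgn.
  by apply/nondecreasing_seqP => n; rewrite seriesSr lerDl sqr_ge0.
exists (fine (\sum_(0 <= n <oo) (gamma n ^+ 2)%:E)%E) => _ [n _ <-].
rewrite -lee_fin fineK// seriesEnat /= -sumEFin.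
by apply: nneseries_lim_ge => k _; rewrite lee_fin sqr_ge0.
Qed.

Let cvg_gamma_sqrC (c : R) : cvgn (series (fun n => gamma n ^+ 2 * c)).
Proof.
rewrite (_ : (fun n => gamma n ^+ 2 * c) = c *: (fun n => gamma n ^+ 2)).
  exact: is_cvg_seriesZ.
by apply/funext => n; rewrite mulrC.
Qed.

Let gamma_sqr_le : exists2 S, 0 <= S & forall n, series (fun k => gamma k ^+ 2) n <= S.
Proof.
have nd : nondecreasing_seq (series (fun n => gamma n ^+ 2)).
  by apply/nondecreasing_seqP => n; rewrite seriesSr lerDl sqr_ge0.
exists (limn (series (fun n => gamma n ^+ 2))).
  apply: le_trans (nondecreasing_cvgn_le nd cvg_gamma_sqr 0%N).
  by rewrite seriesEnat /= big_geq.
by move=> n; exact: (nondecreasing_cvgn_le nd cvg_gamma_sqr n).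
Qed.

Let mean_descent n y z :
  avg (fun k => dot (step n k y - z) (step n k y - z)) <=
  dot (y - z) (y - z) - 2 * gamma n * (F y - F z) + gamma n ^+ 2 * C.
Proof.
apply: (le_trans (le_avg (fun k => descent n k y z))).
have -> : (fun k => dot (y - z) (y - z) - 2 * gamma n * (Phi k y - Phi k z) + gamma n ^+ 2 * C) =
  (fun k => (dot (y - z) (y - z) + gamma n ^+ 2 * C) +
            (- (2 * gamma n)) * (Phi k y + (-1) * Phi k z)).
  by apply/funext => k; ring.
by rewrite avgD avg_cst// avgZ avgD avgZ -/(F y) -/(F z); lra.
Qed.

Let measurable_iter_fun n (h : 'rV[R]_N -> R) : continuous h ->
  measurable_fun setT (fun w => h (x n w)).
Proof. exact: (measurable_iter cP mx0 step_cont xS uY). Qed.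

Let measurable_sqdot n z : measurable_fun setT (fun w => dot (x n w - z) (x n w - z)).
Proof.
apply: (@measurable_iter_fun n (fun y => dot (y - z) (y - z))).
exact: continuous_sqdot.
Qed.

Let continuous_step_comp n k (h : 'rV[R]_N -> R) : continuous h ->
  continuous (fun y => h (step n k y)).
Proof.
by move=> hc y; apply: (@continuous_comp _ _ _ (step n k) h); [exact: step_cont|exact: hc].
Qed.

Let continuous_step_sqdot n k z : continuous (fun y => dot (step n k y - z) (step n k y - z)).
Proof. exact: (@continuous_step_comp n k _ (@continuous_sqdot _ _ z)). Qed.

Let second_moment0 z : exists B, (\int[P]_w (dot (x 0%N w - z) (x 0%N w - z))%:E <= B%:E)%E.
Proof.
have [_] := x0L2; rewrite /moment unlock /= => m_fin.
have sqE w : enorm (x 0%N w) `^ 2 = dot (x 0%N w) (x 0%N w).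
  by rewrite powR_mulrn ?enorm_ge0// enorm_sqr.
have mE : (\int[P]_w (enorm (x 0%N w) `^ 2)%:E = \int[P]_w (dot (x 0%N w) (x 0%N w))%:E)%E.
  by apply: eq_integral => w _; rewrite sqE.
rewrite mE in m_fin.
exists (2 * fine (\int[P]_w (dot (x 0%N w) (x 0%N w))%:E)%E + 2 * dot z z).
apply: (@integral_le_affine _ _ _ _ _ (fun w => dot (x 0%N w) (x 0%N w))) => //.
- exact: measurable_iter_fun continuous_sqnorm.
- by move=> w; exact: dot_ge0.
- by move=> w; exact: dot_ge0.
- by rewrite mulr_ge0// dot_ge0.
- by move=> w; exact: dot_parallelogram.
- rewrite fineK// ge0_fin_numE//.
  by apply: integral_ge0 => w _; rewrite lee_fin dot_ge0.
Qed.

(** The averaged descent inequality at a minimizer, integrated and summed. *)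
Let second_moment z : argmin F z ->
  exists B, forall n, (\int[P]_w (dot (x n w - z) (x n w - z))%:E <= B%:E)%E.
Proof.
move=> Zz; have [B0 B0P] := second_moment0 z.
have [S S0 SP] := gamma_sqr_le.
exists (B0 + S * C) => n.
suff h : (\int[P]_w (dot (x n w - z) (x n w - z))%:E <=
    (B0 + series (fun k => gamma k ^+ 2) n * C)%:E)%E.
  by apply: le_trans h _; rewrite lee_fin lerD2l ler_wpM2r.
elim: n => [|n IHn].
  by rewrite seriesEnat /= big_geq// mul0r addr0.
rewrite (@integral_step _ _ _ _ _ _ _ _ _ cP mx0 step_cont xS uY iY n setT
  (fun w y => dot (y - z) (y - z))); last 4 first.
- exact: (@measurableT _ (g_sigma_algebraType (past x n))).
- by move=> w y; exact: dot_ge0.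
- exact: measurable_sqdot.
- move=> k; apply: (@measurable_past _ _ _ _ x n n
    (fun y => dot (step n k y - z) (step n k y - z))) => //.
rewrite seriesSr mulrDl addrA -[B0 + _]mul1r.
apply: (@integral_le_affine _ _ _ _ _ (fun w => dot (x n w - z) (x n w - z))) => //.
- apply: (@measurable_iter_fun n (fun y => avg (fun k => dot (step n k y - z) (step n k y - z)))).
  apply: continuous_mul; first exact: continuous_cst.
  by apply: continuous_sumr => k; exact: (@continuous_step_sqdot n k z).
- by move=> w; apply: avg_ge0 => // k; exact: dot_ge0.
- by move=> w; exact: dot_ge0.
- by rewrite mulr_ge0// sqr_ge0.
- move=> w; apply: (le_trans (mean_descent n (x n w) z)); rewrite mul1r lerD2r.
  by rewrite gerBl mulr_ge0 ?mulr_ge0 ?(ltW (gamma_gt0 n))// subr_ge0.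
Qed.

Let second_moment_bound : exists2 B, 0 <= B &
  forall n, (\int[P]_w (dot (x n w) (x n w))%:E <= B%:E)%E.
Proof.
have [z Zz] := Z_neq0; have [B BP] := second_moment Zz.
have bound n : (\int[P]_w (dot (x n w) (x n w))%:E <= (2 * B + 2 * dot z z)%:E)%E.
  apply: (@integral_le_affine _ _ _ _ _ (fun w => dot (x n w - z) (x n w - z))) => //.
  - exact: measurable_iter_fun continuous_sqnorm.
  - by move=> w; exact: dot_ge0.
  - by move=> w; exact: dot_ge0.
  - by rewrite mulr_ge0// dot_ge0.
  - move=> w; have := dot_parallelogram (x n w - z) (- z).
    by rewrite opprK subrK !dotNl !dotNr opprK.
exists (2 * B + 2 * dot z z) => //.
rewrite -lee_fin; apply: le_trans (bound 0%N).
by apply: integral_ge0 => w _; rewrite lee_fin dot_ge0.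
Qed.

Let coord_noise_cvg l :
  {ae P, forall w, cvgn (series ((noise x step (fun y : 'rV[R]_N => y 0 l)) ^~ w))}.
Proof.
apply: (@noise_series_cvg _ _ _ _ _ _ _ _ _ K_gt0 cP mx0 step_cont xS uY iY _
  (fun n => gamma n ^+ 2 * C)).
- exact: continuous_coord.
- by move=> n; rewrite mulr_ge0// sqr_ge0.
- exact: cvg_gamma_sqrC.
- move=> n.
  have -> : gamma n ^+ 2 * C = 0 * 0 + gamma n ^+ 2 * C by rewrite mul0r add0r.
  apply: (@integral_le_affine _ _ _ _ _ (cst 0)) => //.
  + apply: (@measurable_iter_fun n (fun y => avg (fun k => (step n k y 0 l - y 0 l) ^+ 2))).
    apply: continuous_mul; first exact: continuous_cst.
    apply: continuous_sumr => k; apply: continuous_sqr; apply: continuous_add.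
      exact: (@continuous_step_comp n k _ (@continuous_coord _ _ l)).
    by apply: continuous_opp; exact: continuous_coord.
  + by move=> w; apply: avg_ge0 => // k; exact: sqr_ge0.
  + by rewrite mulr_ge0// sqr_ge0.
  + move=> w; rewrite mul0r add0r -[leRHS](avg_cst K_gt0); apply: le_avg => k.
    apply: le_trans (displacement n k (x n w)).
    by have := sqr_coord_le (step n k (x n w) - x n w) l; rewrite !mxE.
  + by rewrite integral0.
Qed.

(** Since [|p|^2 - |y|^2 = 2 <y, p - y> + |p - y|^2] and [|p - y| = O(gamma n)], the
    square of the increment is [O(gamma n ^+ 2 * (1 + |y|^2))]. *)
Let sqdot_increment n k y S : gamma n ^+ 2 <= S ->
  (dot (step n k y) (step n k y) - dot y y) ^+ 2 <=
  8 * (gamma n ^+ 2 * C) * dot y y + gamma n ^+ 2 * C * (2 * S * C).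
Proof.
move=> gS; have := displacement n k y.
have [e ->] : exists e, step n k y = y + e.
  by exists (step n k y - y); rewrite addrC subrK.
rewrite addrAC subrr add0r => eC.
have cs := cauchy_schwarz_dot y e.
have e0 := dot_ge0 e; have y0 := dot_ge0 y.
have -> : dot (y + e) (y + e) - dot y y = 2 * dot y e + dot e e.
  by rewrite !dotE (dotC e y); ring.
have gC : gamma n ^+ 2 * C <= S * C by rewrite ler_wpM2r.
have h1 : dot y y * dot e e <= dot y y * (gamma n ^+ 2 * C) by rewrite ler_wpM2l.
have h2 : dot e e * dot e e <= gamma n ^+ 2 * C * (S * C).
  by apply: ler_pM => //; exact: le_trans gC.
have := sqr_ge0 (2 * dot y e - dot e e).
by move: (dot y e) (dot e e) (dot y y) cs h1 h2 {e0 eC y0} => ye ee yy cs h1 h2; nra.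
Qed.

Let sqnorm_noise_cvg :
  {ae P, forall w, cvgn (series ((noise x step (fun y : 'rV[R]_N => dot y y)) ^~ w))}.
Proof.
have [B B0 BP] := second_moment_bound; have [S S0 SP] := gamma_sqr_le.
have gS n : gamma n ^+ 2 <= S.
  have s0 : 0 <= series (fun k => gamma k ^+ 2) n.
    by rewrite seriesEnat /=; apply: sumr_ge0 => k _; exact: sqr_ge0.
  by have := SP n.+1; rewrite seriesSr; lra.
apply: (@noise_series_cvg _ _ _ _ _ _ _ _ _ K_gt0 cP mx0 step_cont xS uY iY _
  (fun n => gamma n ^+ 2 * (C * (8 * B + 2 * S * C)))).
- exact: continuous_sqnorm.
- by move=> n; rewrite mulr_ge0 ?sqr_ge0// mulr_ge0// addr_ge0 ?mulr_ge0.
- exact: cvg_gamma_sqrC.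
- move=> n.
  have -> : gamma n ^+ 2 * (C * (8 * B + 2 * S * C)) =
    8 * (gamma n ^+ 2 * C) * B + gamma n ^+ 2 * C * (2 * S * C) by ring.
  apply: (@integral_le_affine _ _ _ _ _ (fun w => dot (x n w) (x n w))) => //.
  + apply: (@measurable_iter_fun n
      (fun y => avg (fun k => (dot (step n k y) (step n k y) - dot y y) ^+ 2))).
    apply: continuous_mul; first exact: continuous_cst.
    apply: continuous_sumr => k; apply: continuous_sqr; apply: continuous_add.
      exact: (@continuous_step_comp n k _ continuous_sqnorm).
    by apply: continuous_opp; exact: continuous_sqnorm.
  + exact: measurable_iter_fun continuous_sqnorm.
  + by move=> w; apply: avg_ge0 => // k; exact: sqr_ge0.
  + by move=> w; exact: dot_ge0.
  + by rewrite mulr_ge0// mulr_ge0// sqr_ge0.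
  + by apply: mulr_ge0; apply: mulr_ge0 => //; [exact: sqr_ge0|exact: mulr_ge0].
  + move=> w; rewrite -[leRHS](avg_cst K_gt0); apply: le_avg => k.
    exact: sqdot_increment.
Qed.

(** The reason for treating [N + 1] martingales instead of one for each [z]: they
    are finitely many, so a single null set serves all points [z], including
    limit points that depend on the outcome. *)
Let noise_sqdist n w z :
  noise x step (fun y : 'rV[R]_N => dot (y - z) (y - z)) n w =
  noise x step (fun y => dot y y) n w
  - 2 * \sum_(l < N) z 0 l * noise x step (fun y : 'rV[R]_N => y 0 l) n w.
Proof.
have dE y : dot (y - z) (y - z) = dot y y + (-2 * dot y z + dot z z).
  by rewrite !dotE (dotC z y); ring.
have aE : avg (fun k => dot (step n k (x n w)) z) =
    \sum_(l < N) z 0 l * avg (fun k => step n k (x n w) 0 l).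
  rewrite /avg /dot exchange_big mulr_sumr; apply: eq_bigr => l _ /=.
  by rewrite -mulr_suml; ring.
rewrite /noise dE; under [in avg _]eq_fun do rewrite dE.
rewrite !avgD avgZ avg_cst// aE.
have -> : dot (x n.+1 w) z = \sum_(l < N) z 0 l * x n.+1 w 0 l.
  by apply: eq_bigr => l _; rewrite mulrC.
under [X in _ = _ - 2 * X]eq_bigr do rewrite mulrBr.
by rewrite sumrB; ring.
Qed.

(** For a fixed outcome [w], the convergence of the noise series is all that is
    left of the randomness, and the deterministic lemmas apply. *)
Let pathwise_cvg w :
  cvgn (series ((noise x step (fun y : 'rV[R]_N => dot y y)) ^~ w)) ->
  (forall l, cvgn (series ((noise x step (fun y : 'rV[R]_N => y 0 l)) ^~ w))) ->
  exists2 y, argmin F y & x ^~ w @ \oo --> y.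
Proof.
move=> cq cl.
have cD z : cvgn (series ((noise x step (fun y : 'rV[R]_N => dot (y - z) (y - z))) ^~ w)).
  rewrite (_ : (_ ^~ w) = (noise x step (fun y : 'rV[R]_N => dot y y)) ^~ w
     + (-2) *: (fun n =>
       \sum_(l < N) z 0 l * noise x step (fun y : 'rV[R]_N => y 0 l) n w)); last first.
    by apply/funext => n; rewrite noise_sqdist -mulNr.
  apply: is_cvg_seriesD => //; apply: is_cvg_seriesZ.
  elim: (index_enum _) => [|l r IHr].
    under eq_fun do rewrite big_nil.
    rewrite (_ : (fun _ => 0) = 0 *: (noise x step (fun y : 'rV[R]_N => dot y y)) ^~ w).
      exact: is_cvg_seriesZ.
    by rewrite scale0r.
  under eq_fun do rewrite big_cons.
  by apply: is_cvg_seriesD => //; exact: is_cvg_seriesZ.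
have [z0 Zz0] := Z_neq0.
have dS z n : argmin F z -> dot (x n.+1 w - z) (x n.+1 w - z) <=
    dot (x n w - z) (x n w - z) + noise x step (fun y : 'rV[R]_N => dot (y - z) (y - z)) n w
    + gamma n ^+ 2 * C - gamma n * (2 * (F (x n w) - F z)).
  by move=> _; have := mean_descent n (x n w) z; rewrite /noise; lra.
have key z : argmin F z -> cvgn (fun n => dot (x n w - z) (x n w - z)) /\
    exists M, forall n, series (fun n => gamma n * (2 * (F (x n w) - F z))) n <= M.
  move=> Zz; apply: (perturbed_descent_cvg _ _ (fun n => dS z n Zz)) => //.
  - by move=> n; exact: dot_ge0.
  - move=> n; rewrite mulr_ge0 ?(ltW (gamma_gt0 n))// mulr_ge0// subr_ge0.
    exact: Zz.
apply: (fejer_cvg F_cont Zz0) => [z /key[]//|e e0 n].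
have [_ [M MP]] := key z0 Zz0.
have Fz0 k : 0 <= 2 * (F (x k w) - F z0) by rewrite mulr_ge0// subr_ge0; exact: Zz0.
have [m nm Fm] := weighted_sum_liminf gamma_gt0 gamma_sum MP Fz0 e0 n.
by exists m => //; move: Fm (Fz0 m); lra.
Qed.

Let ae_cvg : {ae P, forall w, exists2 y, argmin F y & x ^~ w @ \oo --> y}.
Proof.
have coords := filter_forall (ae_filter_ringOfSetsType P) coord_noise_cvg.
by apply: filterS (filterI sqnorm_noise_cvg coords) => w [] /pathwise_cvg; apply.
Qed.

Let Lp_norm1 (v : T -> 'rV[R]_N) : Lp_norm P 1 v = (\int[P]_w (enorm (v w))%:E)%E.
Proof.
rewrite /Lp_norm /moment invr1 poweRe1 unlock /=.
  by apply: eq_integral => w _; rewrite powRr1// enorm_ge0.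
by apply: integral_ge0 => w _; rewrite lee_fin powR_ge0.
Qed.

Let in_L1 (v : T -> 'rV[R]_N) (B : R) : random_vector v ->
  (\int[P]_w (dot (v w) (v w))%:E <= B%:E)%E -> in_Lp P 1 v.
Proof.
move=> mv vB; split => //; rewrite /moment unlock.
have -> : (\int[P]_w (enorm (v w) `^ 1)%:E = \int[P]_w (enorm (v w))%:E)%E.
  by apply: eq_integral => w _; rewrite powRr1// enorm_ge0.
apply: (@le_lt_trans _ _ (1 * B + 1)%:E); last exact: ltry.
apply: (@integral_le_affine _ _ _ _ _ (fun w => dot (v w) (v w))) => //.
- exact: random_vector_real mv continuous_enorm.
- exact: random_vector_real mv continuous_sqnorm.
- by move=> w; exact: enorm_ge0.
- by move=> w; exact: dot_ge0.
- by move=> w; rewrite -enorm_sqr; have := sqr_ge0 (enorm (v w) - 1); nra.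
Qed.

Lemma stochastic_fejer_cvg : exists xbar : T -> 'rV[R]_N,
  [/\ random_vector xbar, forall w, argmin F (xbar w),
      {ae P, forall w, (fun n => x n w) @ \oo --> xbar w}
    & cvg_in_Lp P 1 x xbar].
Proof.
have [z0 Zz0] := Z_neq0.
have [w|xbar xbarP] := @choice T 'rV[R]_N (fun w y => argmin F y /\
    ((exists2 y', argmin F y' & x ^~ w @ \oo --> y') -> x ^~ w @ \oo --> y)).
  have [[y Zy xy]|nxy] := pselect (exists2 y', argmin F y' & x ^~ w @ \oo --> y').
    by exists y.
  by exists z0.
have xcvg : {ae P, forall w, x ^~ w @ \oo --> xbar w}.
  by apply: filterS ae_cvg => w; exact: (xbarP w).2.
(* The modification x' agrees with x almost surely and converges everywhere,
   which makes xbar measurable and Fatou's lemma directly applicable. *)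
pose x' n w := if `[< x ^~ w @ \oo --> xbar w >] then x n w else xbar w.
have x'x : {ae P, forall w, forall n, x' n w = x n w}.
  by apply: filterS xcvg => w xw n; rewrite /x' asboolT.
have mx' n : random_vector (x' n).
  apply: (random_vector_ae cP _ (mx n)).
  by apply: filterS x'x => w ->.
have x'cvg w : x' ^~ w @ \oo --> xbar w.
  rewrite /x'; case: asboolP => // _; exact: cvg_cst.
have mxbar : random_vector xbar := random_vector_lim mx' x'cvg.
have [B B0 BP] := second_moment_bound.
have xbarB : (\int[P]_w (dot (xbar w) (xbar w))%:E <= B%:E)%E.
  apply: (@fatou_cvg _ _ _ P (fun n w => dot (x' n w) (x' n w))).
  - by move=> n; exact: random_vector_real (mx' n) continuous_sqnorm.
  - by move=> n w; exact: dot_ge0.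
  - move=> w; apply: (@cvg_comp _ _ _ (x' ^~ w) (fun y => dot y y) _ _ _ (x'cvg w)).
    exact: continuous_sqnorm.
  - move=> n; apply: le_trans (BP n); rewrite le_eqVlt; apply/orP; left; apply/eqP.
    apply: ge0_ae_eq_integral => //.
    + by apply/measurable_EFinP; exact: random_vector_real (mx' n) continuous_sqnorm.
    + by apply/measurable_EFinP; exact: random_vector_real (mx n) continuous_sqnorm.
    + by move=> w _; rewrite lee_fin dot_ge0.
    + by move=> w _; rewrite lee_fin dot_ge0.
    + by apply: filterS x'x => w -> _.
exists xbar; split => //; first by move=> w; exact: (xbarP w).1.
split; first by move=> n; exact: in_L1 (mx n) (BP n).
  exact: in_L1 mxbar xbarB.
under eq_fun do rewrite Lp_norm1.
have mdist n : measurable_fun setT (fun w => dot (x n w - xbar w) (x n w - xbar w)).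
  apply: measurable_sum => l.
  suff h : measurable_fun setT (fun w => (x n w - xbar w) 0 l) by exact: measurable_funM.
  under eq_fun do rewrite !mxE.
  apply: measurable_funB.
    exact: random_vector_real (mx n) (@continuous_coord _ _ l).
  exact: random_vector_real mxbar (@continuous_coord _ _ l).
apply: (@L2_bounded_L1_cvg _ _ _ P _ (2 * (B + B) + 0)).
- by move=> n; apply: (measurableT_comp (continuous_measurable_fun (@sqrt_continuous R))).
- by move=> n w; exact: enorm_ge0.
- apply: filterS xcvg => w xw.
  have e0 : enorm (xbar w - xbar w) = 0 by rewrite subrr /enorm dot0l sqrtr0.
  rewrite -e0.
  apply: (@cvg_comp _ _ _ (x ^~ w) (fun y : 'rV[R]_N => enorm (y - xbar w)) _ _ _ xw).
  suff ce : continuous (fun y : 'rV[R]_N => enorm (y - xbar w)) by exact: ce.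
  by apply: continuous_compr; [exact: continuous_sqdot|exact: sqrt_continuous].
- move=> n; under eq_integral do rewrite enorm_sqr.
  have mx1 : measurable_fun setT (fun w => dot (x n w) (x n w)).
    exact: random_vector_real (mx n) continuous_sqnorm.
  have mx2 : measurable_fun setT (fun w => dot (xbar w) (xbar w)).
    exact: random_vector_real mxbar continuous_sqnorm.
  apply: (@integral_le_affine _ _ _ _ _
    (fun w => dot (x n w) (x n w) + dot (xbar w) (xbar w))) => //.
  + exact: measurable_funD.
  + by move=> w; exact: dot_ge0.
  + by move=> w; rewrite addr_ge0// dot_ge0.
  + by move=> w; rewrite addr0 mulrDr dot_parallelogram.
  + under eq_integral do rewrite EFinD.
    rewrite ge0_integralD//; first by rewrite EFinD; apply: leeD => //; exact: BP.
    * by move=> w _; rewrite lee_fin dot_ge0.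
    * exact/measurable_EFinP.
    * by move=> w _; rewrite lee_fin dot_ge0.
    * exact/measurable_EFinP.
Qed.

End stochastic_fejer.

(** * The stochastic forward-backward algorithm *)

Theorem proposition4p2 (R : realType) (N : nat) (K1 K2 : finType)
    (K1_neq0 : (0 < #|K1|)%N) (K2_neq0 : (0 < #|K2|)%N)
    (u1 : K1 -> 'rV[R]_N) (xi1 : K1 -> R)
    (u2 : K2 -> 'rV[R]_N) (xi2 : K2 -> R)
    (xi1_sign : forall k, xi1 k = -1 \/ xi1 k = 1)
    (xi2_sign : forall k, xi2 k = -1 \/ xi2 k = 1)
    (alpha : R) (alpha_gt0 : 0 < alpha) (alpha_lt1 : alpha < 1)
    (d : measure_display) (T : measurableType d) (P : probability T R)
    (x : nat -> T -> 'rV[R]_N) (i : nat -> T -> K1) (j : nat -> T -> K2)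
    (gamma : nat -> R) :
  let f := fun k : K1 => hinge alpha (u1 k) (xi1 k) in
  let g := fun k : K2 => logistic alpha (u2 k) (xi2 k) in
  let Z := argmin (fun z : 'rV[R]_N =>
             #|K1|%:R^-1 * (\sum_(k : K1) f k z) +
             #|K2|%:R^-1 * (\sum_(k : K2) g k z)) in
  Z !=set0 ->
  measure_is_complete P ->
  in_Lp P 2 (x 0%N) ->
  (forall n, 0 < gamma n) ->
  (\sum_(0 <= n <oo) (gamma n)%:E = +oo)%E ->
  (\sum_(0 <= n <oo) (gamma n ^+ 2)%:E < +oo)%E ->
  (forall n, {ae P, forall w,
     x n.+1 w = prox (fun z => (gamma n * f (i n w) z)%:E)
                     (x n w - gamma n *: grad (g (j n w)) (x n w))}) ->
  (forall n, uniform_rv P (fun w => (i n w, j n w))) ->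
  (forall n, independent_of P (fun w => (i n w, j n w)) (sigma_upto x n)) ->
  exists xbar : T -> 'rV[R]_N,
    [/\ random_vector xbar,
        forall w, Z (xbar w),
        {ae P, forall w, (fun n => x n w) @ \oo --> xbar w}
      & cvg_in_Lp P 1 x xbar].
Proof.
move=> f g Z Z0 cP x0L2 gamma_gt0 gsum gsqr xS uY iY.
pose K := (K1 * K2)%type.
pose step n (k : K) := fb_step alpha (xi1 k.1) (xi2 k.2) (u1 k.1) (u2 k.2) (gamma n).
pose Phi (k : K) y := f k.1 y + g k.2 y.
pose C := \sum_(k : K1) 8 * dot (u1 k) (u1 k) + \sum_(k : K2) 8 * dot (u2 k) (u2 k).
have sgn r : r = -1 \/ r = 1 -> r ^+ 2 = 1 :> R.
  by case=> ->; rewrite ?sqrrN expr1n.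
have xi1_sqr k := sgn _ (xi1_sign k); have xi2_sqr k := sgn _ (xi2_sign k).
have le_sum (L : finType) (u : L -> 'rV[R]_N) k :
    8 * dot (u k) (u k) <= \sum_(k : L) 8 * dot (u k) (u k).
  rewrite (bigD1 k)//= lerDl; apply: sumr_ge0 => l _.
  by rewrite mulr_ge0// dot_ge0.
have le_C k : 8 * dot (u1 k.1) (u1 k.1) + 8 * dot (u2 k.2) (u2 k.2) <= C.
  by apply: lerD; exact: le_sum.
have C0 : 0 <= C.
  by apply: addr_ge0; apply: sumr_ge0 => k _; rewrite mulr_ge0// dot_ge0.
have gamma0 n : 0 <= gamma n by exact: ltW.
have FE : (fun z => #|K1|%:R^-1 * (\sum_(k : K1) f k z) + #|K2|%:R^-1 * (\sum_(k : K2) g k z))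
    = (fun z => avg (fun k => Phi k z)).
  by apply/funext => z; rewrite (avg_prod (f ^~ z) (g ^~ z)).
rewrite /Z FE in Z0 *.
apply: (@stochastic_fejer_cvg R N d T P K x (fun n w => (i n w, j n w)) step Phi gamma C) => //.
- by rewrite card_prod muln_gt0 K1_neq0.
- by move=> n k; exact: continuous_fb_step.
- move=> n; apply: filterS (xS n) => w ->.
  by apply: prox_hinge => //; rewrite mulr_ge0// ltW.
- by move=> k; apply: continuous_add; [exact: continuous_hinge|exact: continuous_logistic].
- move=> n k y; apply: le_trans (fb_step_displacement _ _ _ _ _ _ _ _) _ => //.
  rewrite ler_wpM2l ?sqr_ge0//; apply: le_trans (le_C k).
  by have := dot_ge0 (u1 k.1); have := dot_ge0 (u2 k.2); lra.
- move=> n k y z; apply: le_trans (fb_step_descent _ _ _ _ _ _ _ _ _) _ => //.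
  by rewrite lerD2l ler_wpM2l ?sqr_ge0.
Qed.
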